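(* For each $k=-1,0,\ldots,K$, the coefficient $C_X^{(k)}(x|x_0)$ in the log-likelihood expansion $$l_X^{(K)}(x|x_0,\Delta)=-\frac m2\ln(2\pi\Delta)-D_v(x)+\frac{C_X^{(-1)}(x|x_0)}{\Delta}+\sum_{k=0}^KC_X^{(k)}(x|x_0)\frac{\Delta^k}{k!}$$ solves the equation $$f_X^{(k-1)}(x|x_0)=0,$$ where $$f_X^{(-2)}(x|x_0)=-2C_X^{(-1)}(x|x_0)-\sum_{i,j=1}^mv_{ij}(x)\frac{\partial C_X^{(-1)}(x|x_0)}{\partial x_i}\frac{\partial C_X^{(-1)}(x|x_0)}{\partial x_j},$$ $$f_X^{(-1)}(x|x_0)=-\sum_{i,j=1}^mv_{ij}(x)\frac{\partial C_X^{(-1)}(x|x_0)}{\partial x_i}\frac{\partial C_X^{(0)}(x|x_0)}{\partial x_j}-G_X^{(0)}(x|x_0)$$ and, for $k\ge1$, $$f_X^{(k-1)}(x|x_0)=C_X^{(k)}(x|x_0)-\frac1k\sum_{i,j=1}^mv_{ij}(x)\frac{\partial C_X^{(-1)}(x|x_0)}{\partial x_i}\frac{\partial C_X^{(k)}(x|x_0)}{\partial x_j}-G_X^{(k)}(x|x_0),$$ with the functions $G_X^{(k)}$, $k=0,1,\ldots,K$, as defined in the context. The coefficients $\beta_i^{(k)}(x_0)$, $i\in I_k$, of the expansion $C_X^{(j_k,k)}$ of $C_X^{(k)}$ in powers of $x-x_0$ solve a system of linear equations, whose solution is explicit.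
   Context: Setting. $X$ is a diffusion $dX_t=\mu(X_t)\,dt+\sigma(X_t)\,dW_t$ in dimension $m$ ($W$ a vector of $m$ independent Brownian motions, $\sigma$ an $m\times m$ matrix), $v(x)=\sigma(x)\sigma(x)^T$, and $D_v(x)=\frac12\ln(\mathrm{Det}[v(x)])$. $X$ need not be reducible (transformable by an invertible smooth map to a diffusion with identity diffusion matrix). Standing assumptions: (1) the domain $\mathcal{S}_X\subseteq\mathbb{R}^m$ is a product of $m$ intervals, possibly infinite (open at infinite limits); (2) $v(x)$ is positive definite on the interior of $\mathcal{S}_X$; (3) $\mu,\sigma$ are infinitely differentiable on $\mathcal{S}_X$; (4) $|\mu_i(x)|,|\sigma_{ij}(x)|\le\mathrm{const}\cdot(1+\|x\|)$ and the derivatives of $\mu,\sigma$ have at most polynomial growth. Let $p_X(x|x_0,\Delta)$ be the transition density (density of $X_{t+\Delta}=x$ given $X_t=x_0$) and $l_X=\ln p_X$. The forward Kolmogorov equation for $l_X$ is $$\frac{\partial l_X}{\partial\Delta}=-\sum_i\frac{\partial\mu_i(x)}{\partial x_i}+\frac12\sum_{i,j}\frac{\partial^2v_{ij}(x)}{\partial x_i\partial x_j}-\sum_i\mu_i(x)\frac{\partial l_X}{\partial x_i}+\sum_{i,j}\frac{\partial v_{ij}(x)}{\partial x_i}\frac{\partial l_X}{\partial x_j}+\frac12\sum_{i,j}v_{ij}(x)\frac{\partial^2l_X}{\partial x_i\partial x_j}+\frac12\sum_{i,j}\frac{\partial l_X}{\partial x_i}v_{ij}(x)\frac{\partial l_X}{\partial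 x_j}.$$ The expansion. The postulated form $l_X^{(K)}$ displayed in the claim, with smooth coefficients $C_X^{(k)}$ independent of $\Delta$, is substituted for $l_X$ in the Kolmogorov forward equation, and the coefficients are determined by requiring that the terms of orders $\Delta^{-2},\Delta^{-1},\ldots,\Delta^{K-1}$ in the difference between the two sides vanish, with the Gaussian limiting behavior as $\Delta\to0$ ($C_X^{(-1)}(\cdot|x_0)$ has its strict maximum at $x=x_0$, being minus one half the squared distance from $x$ to $x_0$ in the metric induced by $v(x)^{-1}$, and $C_X^{(0)}(x_0|x_0)=0$). The functions $G_X^{(k)}$ (all sums over indices from $1$ to $m$; arguments $(x|x_0)$ of the $C_X^{(\cdot)}$ and $x$ of $\mu,v,D_v$ omitted): $$G_X^{(0)}=\frac m2-\sum_i\mu_i\frac{\partial C_X^{(-1)}}{\partial x_i}+\sum_{i,j}\frac{\partial v_{ij}}{\partial x_i}\frac{\partial C_X^{(-1)}}{\partial x_j}+\frac12\sum_{i,j}v_{ij}\frac{\partial^2C_X^{(-1)}}{\partial x_i\partial x_j}-\sum_{i,j}v_{ij}\frac{\partial C_X^{(-1)}}{\partial x_i}\frac{\partial D_v}{\partial x_j},$$ $$G_X^{(1)}=-\sum_i\frac{\partial\mu_i}{\partial x_i}+\frac12\sum_{i,j}\frac{\partial^2v_{ij}}{\partial x_i\partial x_j}-\sum_i\mu_i\left(\frac{\partial C_X^{(0)}}{\partial x_i}-\frac{\partial D_v}{\partial x_i}\right)+\sum_{i,j}\frac{\partial v_{ij}}{\partial x_i}\left(\frac{\partial C_X^{(0)}}{\partial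 x_j}-\frac{\partial D_v}{\partial x_j}\right)$$ $$\qquad+\frac12\sum_{i,j}v_{ij}\left\{\frac{\partial^2C_X^{(0)}}{\partial x_i\partial x_j}-\frac{\partial^2D_v}{\partial x_i\partial x_j}+\left(\frac{\partial C_X^{(0)}}{\partial x_i}-\frac{\partial D_v}{\partial x_i}\right)\left(\frac{\partial C_X^{(0)}}{\partial x_j}-\frac{\partial D_v}{\partial x_j}\right)\right\},$$ and for $k\ge2$, $$G_X^{(k)}=-\sum_i\mu_i\frac{\partial C_X^{(k-1)}}{\partial x_i}+\sum_{i,j}\frac{\partial v_{ij}}{\partial x_i}\frac{\partial C_X^{(k-1)}}{\partial x_j}+\frac12\sum_{i,j}v_{ij}\frac{\partial^2C_X^{(k-1)}}{\partial x_i\partial x_j}$$ $$\qquad+\frac12\sum_{i,j}v_{ij}\left\{\left(\frac{\partial C_X^{(0)}}{\partial x_i}-2\frac{\partial D_v}{\partial x_i}\right)\frac{\partial C_X^{(k-1)}}{\partial x_j}+\sum_{h=0}^{k-2}\binom{k-1}{h}\frac{\partial C_X^{(h)}}{\partial x_i}\frac{\partial C_X^{(k-1-h)}}{\partial x_j}\right\}.$$ Expansion in the state variable. For $k=-1,\ldots,K$ let $j_k=2(K+1-k)$ and $I_k=\{i=(i_1,\ldots,i_m)\in\mathbb{N}^m:0\le\mathrm{tr}[i]\le j_k\}$, where $\mathrm{tr}[i]=i_1+\cdots+i_m$. $C_X^{(j_k,k)}$ denotes the Taylor expansion of $C_X^{(k)}(x|x_0)$ in $x$ about $x_0$ at order $j_k$,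 written $$C_X^{(j_k,k)}(x|x_0)=\sum_{i\in I_k}\beta_i^{(k)}(x_0)(x_1-x_{01})^{i_1}\cdots(x_m-x_{0m})^{i_m}.$$ The $\beta_i^{(k)}$, $i\in I_k$, are determined by setting to zero the expansion of $f_X^{(k-1)}$ at order $j_k$ in $x-x_0$, successively for $k=-1,0,\ldots,K$ and, for each $k$, successively for $\mathrm{tr}[i]=0,1,\ldots,j_k$; the assertion about linear systems is understood in this successive sense (at each step the unknowns are the $\beta_i^{(k)}$ with a given value of $\mathrm{tr}[i]$, and previously determined coefficients and derivatives of $\mu,v$ at $x_0$ are known). The starting terms are: for $k=-1$, $\beta_i^{(-1)}=0$ when $\mathrm{tr}[i]\in\{0,1\}$ and the terms with $\mathrm{tr}[i]=2$ sum to $-\frac12(x-x_0)^Tv^{-1}(x_0)(x-x_0)$, so that only the terms with $\mathrm{tr}[i]=3,\ldots,j_{-1}$ need to be determined; for $k=0$, $\beta_i^{(0)}=0$ when $\mathrm{tr}[i]=0$. *)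

(* Defs.v *)
From HB Require Import structures.
From mathcomp Require Import all_boot all_order all_algebra.
From mathcomp Require Import all_classical all_reals all_analysis.

Set Implicit Arguments.
Unset Strict Implicit.
Unset Printing Implicit Defensive.

Import Order.TTheory GRing.Theory Num.Theory.
Import numFieldNormedType.Exports.

Local Open Scope classical_set_scope.
Local Open Scope ring_scope.

(* Points of R^m are row vectors, with the topology of 'rV[R]_m. *)

Section Calculus.
Context {R : realType} {m : nat}.
Local Notation E := 'rV[R]_m.

Definition enorm (x : E) : R := Num.sqrt (\sum_(i < m) x ord0 i ^+ 2).

Definition pd (i : 'I_m) (f : E -> R) : E -> R :=
  fun x => 'D_(delta_mx ord0 i) f x.

Definition iterpd (s : seq 'I_m) (f : E -> R) : E -> R := foldr pd f s.

(* For an open S this says that all the iterated partial derivatives of f exist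
   and are differentiable on S; for a general S, that f is on S the restriction
   of such a function defined on an open set containing S. *)
Definition smooth_on (S : set E) (f : E -> R) : Prop :=
  exists (O : set E) (g : E -> R),
    [/\ open O, S `<=` O,
        forall s x, O x -> differentiable (iterpd s g) x
      & forall x, S x -> f x = g x].

Definition multi := {ffun 'I_m -> nat}.

Definition tr (i : multi) : nat := (\sum_(l < m) i l)%N.

(* The multi-indices of trace at most n, each listed once
   (see mem_midx and midx_uniq). *)
Definition midx (n : nat) : seq multi :=
  [seq [ffun l => val (i l)] |
     i : {ffun 'I_m -> 'I_n.+1} in
       [pred i : {ffun 'I_m -> 'I_n.+1} | (\sum_(l < m) i l <= n)%N]].

Lemma mem_midx n (i : multi) : (i \in midx n) = (tr i <= n)%N.
Proof.
apply/mapP/idP => [[j]|le_in].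
  rewrite mem_enum inE => lejn ->; rewrite /tr.
  by under eq_bigr do rewrite ffunE.
have le_i l : (i l < n.+1)%N.
  by rewrite ltnS (leq_trans _ le_in)// /tr (bigD1 l)//= leq_addr.
exists [ffun l => Ordinal (le_i l)]; last by apply/ffunP => l; rewrite !ffunE.
by rewrite mem_enum inE; under eq_bigr do rewrite ffunE.
Qed.

Lemma midx_uniq n : uniq (midx n).
Proof.
rewrite map_inj_uniq ?enum_uniq// => i j /ffunP eij.
by apply/ffunP => l; apply/val_inj; have := eij l; rewrite !ffunE.
Qed.

Definition monomial (x0 : E) (i : multi) (x : E) : R :=
  \prod_(l < m) (x ord0 l - x0 ord0 l) ^+ i l.

(* The coefficient of monomial x0 i in the Taylor expansion of f about x0. *)
Definition taylor_coef (f : E -> R) (x0 : E) (i : multi) : R :=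
  iterpd (flatten [seq nseq (i l) l | l <- enum 'I_m]) f x0
  / (\prod_(l < m) (i l)`!)%:R.

Definition tpoly (n : nat) (x0 : E) (g : multi -> R) : E -> R :=
  fun x => \sum_(i <- midx n) g i * monomial x0 i x.

Definition posdef (A : 'M[R]_m) : Prop :=
  forall y : E, y != 0 -> 0 < (y *m A *m y^T) ord0 ord0.

(* Riemannian distance on the open set U for the metric v^-1: the infimum of
   the lengths of the C^1 curves in U parametrized by [0, 1]. A C^1 curve on
   [0, 1] is viewed as the restriction of one on the whole line. *)
Definition C1_path (U : set E) (x y : E) (gamma : R -> E) : Prop :=
  [/\ forall t, derivable gamma t 1, continuous (derive1 gamma),
      forall t, t \in `[0, 1] -> U (gamma t), gamma 0 = x & gamma 1 = y].

Definition path_length (v : E -> 'M[R]_m) (gamma : R -> E) : R :=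
  \int[lebesgue_measure]_(t in `[0, 1])
     Num.sqrt ((derive1 gamma t *m invmx (v (gamma t)) *m (derive1 gamma t)^T)
                 ord0 ord0).

Definition geo_dist (U : set E) (v : E -> 'M[R]_m) (x y : E) : R :=
  inf [set path_length v gamma | gamma in C1_path U x y].

End Calculus.

Section Diffusion.
Context {R : realType} {m : nat}.
Local Notation E := 'rV[R]_m.
Local Notation multi := (@multi m).

Definition box (I : 'I_m -> interval R) : set E :=
  [set x | forall i, x ord0 i \in I i].

Definition diffusion_mx (sigma : E -> 'M[R]_m) : E -> 'M[R]_m :=
  fun x => sigma x *m (sigma x)^T.

Record standing (I : 'I_m -> interval R) (mu : E -> E)
    (sigma : E -> 'M[R]_m) : Prop := {
  _ : forall x, interior (box I) x -> posdef (diffusion_mx sigma x) ;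
  _ : forall i, smooth_on (box I) (fun x => mu x ord0 i) ;
  _ : forall i j, smooth_on (box I) (fun x => sigma x i j) ;
  _ : exists c : R, forall x, box I x ->
        (forall i, `|mu x ord0 i| <= c * (1 + enorm x)) /\
        (forall i j, `|sigma x i j| <= c * (1 + enorm x)) ;
  _ : forall s : seq 'I_m, s != [::] ->
        exists (c : R) (p : nat), forall x, interior (box I) x ->
          (forall i, `|iterpd s (fun y => mu y ord0 i) x|
                       <= c * (1 + enorm x ^+ p)) /\
          (forall i j, `|iterpd s (fun y => sigma y i j) x|
                       <= c * (1 + enorm x ^+ p))
}.

Variables (mu : E -> E) (v : E -> 'M[R]_m).

Let vc (i j : 'I_m) : E -> R := fun x => v x i j.
Let muc (i : 'I_m) : E -> R := fun x => mu x ord0 i.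

Definition Dv : E -> R := fun x => 2^-1 * ln (\det (v x)).

(* Right-hand side of the forward Kolmogorov equation for the logarithm l of
   the transition density, at a fixed time step. *)
Definition kolmogorov_rhs (l : E -> R) (x : E) : R :=
  - (\sum_i pd i (muc i) x)
  + 2^-1 * (\sum_i \sum_j pd i (pd j (vc i j)) x)
  - (\sum_i muc i x * pd i l x)
  + (\sum_i \sum_j pd i (vc i j) x * pd j l x)
  + 2^-1 * (\sum_i \sum_j vc i j x * pd i (pd j l) x)
  + 2^-1 * (\sum_i \sum_j pd i l x * vc i j x * pd j l x).

(* From here on the initial point x0 is fixed and C k x stands for the
   coefficient C^(k)(x | x0), for k = -1, 0, ..., K; the values of C at the
   other indices are never used. *)

Definition log_expansion (K : nat) (C : int -> E -> R) (Delta : R) (x : E) : R :=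
  - (m%:R / 2) * ln (2 * pi * Delta) - Dv x + C (-1) x / Delta
  + \sum_(k < K.+1) C k%:Z x * (Delta ^+ k / k`!%:R).

Definition kolmogorov_diff (l : R -> E -> R) (Delta : R) (x : E) : R :=
  derive1 (fun d => l d x) Delta - kolmogorov_rhs (l Delta) x.

Definition GX0 (C : int -> E -> R) (x : E) : R :=
  m%:R / 2
  - (\sum_i muc i x * pd i (C (-1)) x)
  + (\sum_i \sum_j pd i (vc i j) x * pd j (C (-1)) x)
  + 2^-1 * (\sum_i \sum_j vc i j x * pd i (pd j (C (-1))) x)
  - (\sum_i \sum_j vc i j x * pd i (C (-1)) x * pd j Dv x).

Definition GX1 (C : int -> E -> R) (x : E) : R :=
  - (\sum_i pd i (muc i) x)
  + 2^-1 * (\sum_i \sum_j pd i (pd j (vc i j)) x)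
  - (\sum_i muc i x * (pd i (C 0) x - pd i Dv x))
  + (\sum_i \sum_j pd i (vc i j) x * (pd j (C 0) x - pd j Dv x))
  + 2^-1 * (\sum_i \sum_j vc i j x *
      (pd i (pd j (C 0)) x - pd i (pd j Dv) x
       + (pd i (C 0) x - pd i Dv x) * (pd j (C 0) x - pd j Dv x))).

Definition GX2 (C : int -> E -> R) (k : nat) (x : E) : R :=
  let C1 := C (k.-1)%:Z in
  - (\sum_i muc i x * pd i C1 x)
  + (\sum_i \sum_j pd i (vc i j) x * pd j C1 x)
  + 2^-1 * (\sum_i \sum_j vc i j x * pd i (pd j C1) x)
  + 2^-1 * (\sum_i \sum_j vc i j x *
      ((pd i (C 0) x - 2 * pd i Dv x) * pd j C1 x
       + \sum_(0 <= h < k.-1)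
           'C(k.-1, h)%:R * pd i (C h%:Z) x * pd j (C (k.-1 - h)%N%:Z) x)).

Definition GX (C : int -> E -> R) (k : nat) (x : E) : R :=
  match k with 0%N => GX0 C x | 1%N => GX1 C x | _ => GX2 C k x end.

(* fX C p is f^(p); its values for p < -2 are irrelevant. *)
Definition fX (C : int -> E -> R) (p : int) (x : E) : R :=
  let cross f := \sum_i \sum_j vc i j x * pd i (C (-1)) x * pd j f x in
  if p == -2 then - 2 * C (-1) x - cross (C (-1))
  else if p == -1 then - cross (C 0) - GX C 0 x
  else let k := `|(p + 1)%R|%N in
       C k%:Z x - k%:R^-1 * cross (C k%:Z) - GX C k x.

(* F is a Laurent polynomial in Delta > 0 with lowest order at least lo,
   whose terms of orders lo, ..., hi vanish. *)
Definition laurent_terms_vanish (lo hi : int) (F : R -> R) : Prop :=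
  exists (a : int -> R) (N : nat),
    (forall Delta, 0 < Delta ->
       F Delta = \sum_(h < N) a (lo + h%:Z) * Delta ^ (lo + h%:Z)) /\
    (forall n : int, lo <= n <= hi -> a n = 0).

Record expansion_coefs (U : set E) (K : nat) (x0 : E)
    (C : int -> E -> R) : Prop := {
  _ : forall k : int, -1 <= k <= K%:Z -> smooth_on U (C k) ;
  _ : forall x, U x ->
        laurent_terms_vanish (-2) (K%:Z - 1)
          (fun Delta => kolmogorov_diff (log_expansion K C) Delta x) ;
  _ : forall x, U x -> x != x0 -> C (-1) x < C (-1) x0 ;
  _ : forall x, U x -> C (-1) x = - 2^-1 * geo_dist U v x x0 ^+ 2 ;
  _ : C 0 x0 = 0
}.

(* j_k *)
Definition jord (K : nat) (k : int) : nat := `|(2 * (K%:Z + 1 - k))%R|%N.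

(* The coefficient of (x - x0)^i in f^(k-1) when C^(k) is replaced by the
   polynomial in x - x0 with coefficients g, and every other C^(h) by the one
   with coefficients beta h, at the orders j_k and j_h. *)
Definition expansion_eqn (K : nat) (x0 : E) (beta : int -> multi -> R)
    (k : int) (g : multi -> R) (i : multi) : R :=
  taylor_coef
    (fX (fun h => tpoly (jord K h) x0 (if h == k then g else beta h)) (k - 1))
    x0 i.

(* Least trace for which the coefficients of C^(k) are not starting terms. *)
Definition first_unknown (k : int) : nat :=
  if k == -1 then 3%N else if k == 0 then 1%N else 0%N.

(* Diagonal entry of the linear system for the coefficients of C^(k) of trace
   n: the multiplier in f^(k-1) of a homogeneous polynomial of degree n in
   C^(k), obtained by Euler's identity from the leading term
   - (x - x0)^T v(x0)^-1 (x - x0) / 2 of C^(-1). *)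
Definition pivot (k : int) (n : nat) : R :=
  if k == -1 then 2 * (n%:R - 1)
  else if k == 0 then n%:R else 1 + n%:R / k%:~R.

(* Minus the equation evaluated with every coefficient of C^(k) of trace at
   least n set to 0, over the diagonal entry. *)
Definition explicit_solution (K : nat) (x0 : E) (beta : int -> multi -> R)
    (k : int) (n : nat) (i : multi) : R :=
  - expansion_eqn K x0 beta k
      (fun l => if (tr l < n)%N then beta k l else 0) i / pivot k n.

(* Step n of the determination of beta k: the unknowns are the coefficients of
   trace n, those of smaller trace and the beta h with h < k being known. The
   coefficients g l with tr l > n are arbitrary and drop out. *)
Definition linear_step (K : nat) (x0 : E) (beta : int -> multi -> R)
    (k : int) (n : nat) : Prop :=
  let known g := forall l : multi, (tr l < n)%N -> g l = beta k l in
  let eqn := expansion_eqn K x0 beta k in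
  [/\ exists (A : multi -> multi -> R) (b : multi -> R),
        forall g, known g -> forall i, tr i = n ->
          eqn g i = \sum_(l <- midx n | tr l == n) A i l * g l - b i,
      forall i, tr i = n -> eqn (beta k) i = 0
    & forall g, known g ->
        (forall i, tr i = n -> eqn g i = 0) <->
        (forall i, tr i = n -> g i = explicit_solution K x0 beta k n i)].

Definition starting_terms (x0 : E) (beta : int -> multi -> R) : Prop :=
  [/\ forall i, (tr i <= 1)%N -> beta (-1) i = 0,
      forall x : E,
        \sum_(i <- midx 2 | tr i == 2%N) beta (-1) i * monomial x0 i x =
        - 2^-1 * ((x - x0) *m invmx (v x0) *m (x - x0)^T) ord0 ord0
    & forall i, tr i = 0%N -> beta 0 i = 0].

End Diffusion.

(* Main.v *)
Require Import Defs.
From HB Require Import structures.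
From mathcomp Require Import all_boot all_order all_algebra.
From mathcomp Require Import all_classical all_reals all_analysis.
From mathcomp Require Import zify ring lra.

Set Implicit Arguments.
Unset Strict Implicit.
Unset Printing Implicit Defensive.

Import Order.TTheory GRing.Theory Num.Theory.
Import numFieldNormedType.Exports.

Local Open Scope classical_set_scope.
Local Open Scope ring_scope.

(** The proof has three parts.

    Substituting the expansion into the Kolmogorov equation and multiplying by
    [Delta ^ 2] gives, at each point, a polynomial in [Delta]. Its coefficient of
    degree k + 1 is f^(k-1), up to a nonzero factor ([fX_m2E], [fX_m1E],
    [fX_ge0E]). A polynomial is determined by its values at positive [Delta], so
    these coefficients vanish for k <= K ([fX_eq0]).

    The starting terms express that the Hessian H of C^(-1) at [x0] is minus the
    inverse of v(x0) ([hessianE]). The equation for C = C^(-1) is the eikonal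
    equation - 2 C = |grad C|^2, the norm being that of the metric v^-1. At the
    maximum [x0] the gradient vanishes, hence so does C, and two differentiations
    give H + H v H = 0. That H is invertible follows from quadratic growth
    - 2 C >= c |x - x0|^2 ([quadratic_growth]): the function sqrt (- 2 C) has
    slope one away from its unique zero, so it is bounded below by a multiple of
    the distance to this zero. This is an error bound in the manner of Ekeland:
    at a minimizer of sqrt (- 2 C(y)) + c |y - x| over y the slope of the first
    term is at most c, so the minimizer must be the zero.

    The linear systems rest on a calculus of jets at [x0]. The relation [jet_eq]
    is stable under sums and products and loses one order per derivative. This
    loss is compensated in two ways. Second derivatives only hit coefficients of
    smaller index, which are known to two more orders. The first derivatives of
    C^(k) are multiplied by the gradient of C^(-1), which vanishes at [x0]. Hence
    the truncated coefficients still satisfy the equations at the required orders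
    ([fX_jet], [expansion_eqn_beta]). By the value of the Hessian, the vector
    v grad C^(-1) is - (x - x0) up to second order ([radial_gradient]), so by
    Euler's identity the cross term of f^(k-1) multiplies the homogeneous part of
    degree n of C^(k) by - n, modulo higher degrees ([taylor_coef_cross]).
    Therefore the equations of degree n are a scalar system in the unknowns of
    degree n ([expansion_eqnE]), with a nonzero scalar above the degrees of the
    starting terms, and the solution is obtained by a division. *)

(** * Smooth functions and their partial derivatives *)

Lemma near_eq_differentiable (R : numFieldType) (V W : normedModType R)
    (f g : V -> W) (x : V) :
  {near x, f =1 g} -> differentiable f x -> differentiable g x.
Proof.
move=> fg df; have fgx : f x = g x by exact: nbhs_singleton fg.
have dg : g \o shift x = cst (g x) + 'd f x +o_ 0 id.
  apply/eqaddoP => _/posnumP[e].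
  have /eqaddoP/(_ e%:num (gt0 e)) dfe := diff_locally df.
  have fg0 : \forall h \near 0, f (h + x) = g (h + x).
    by move: fg; rewrite (near_shift 0) /=; apply: filterS => h /=; rewrite subr0.
  by apply: filterS2 fg0 dfe => h fgh; rewrite !fctE /= fgx -fgh.
have dfc := diff_continuous df.
by apply/diff_locallyP; rewrite (diff_unique dfc dg).
Qed.

Section SmoothFunctions.
Context {R : realType} {m : nat}.
Local Notation E := 'rV[R]_m.
Implicit Types (f g : E -> R) (s t : seq 'I_m) (x : E).

Lemma pdD i f g x : differentiable f x -> differentiable g x ->
  pd i (fun y => f y + g y) x = pd i f x + pd i g x.
Proof. by move=> df dg; rewrite /pd [LHS]deriveD//; exact: diff_derivable. Qed.

Lemma pdN i f x : differentiable f x -> pd i (fun y => - f y) x = - pd i f x.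
Proof. by move=> df; rewrite /pd [LHS]deriveN//; exact: diff_derivable. Qed.

Lemma pdM i f g x : differentiable f x -> differentiable g x ->
  pd i (fun y => f y * g y) x = pd i f x * g x + f x * pd i g x.
Proof.
move=> df dg; rewrite /pd [LHS]deriveM; try exact: diff_derivable.
by rewrite addrC; congr (_ + _); exact: mulrC.
Qed.

Lemma pd_cst i (a : R) x : pd i (fun=> a) x = 0.
Proof. exact: derive_cst. Qed.

Variables (U : set E) (oU : open U).

Lemma pd_eq i f g : {in U, f =1 g} -> {in U, pd i f =1 pd i g}.
Proof.
move=> fg x; rewrite inE => Ux; apply: near_eq_derive.
by near=> y; apply: fg; rewrite inE; near: y; exact: open_nbhs_nbhs.
Unshelve. all: by end_near. Qed.

Lemma iterpd_eq s f g : {in U, f =1 g} -> {in U, iterpd s f =1 iterpd s g}.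
Proof. by move=> fg; elim: s => //= i s IHs; exact: pd_eq. Qed.

Lemma iterpd_rcons s i f : iterpd (rcons s i) f = iterpd s (pd i f).
Proof. by rewrite /iterpd foldr_rcons. Qed.

Lemma iterpd_cat s t f : iterpd (s ++ t) f = iterpd s (iterpd t f).
Proof. by rewrite /iterpd foldr_cat. Qed.

Lemma differentiable_eq f g x : {in U, f =1 g} -> U x ->
  differentiable f x -> differentiable g x.
Proof.
move=> fg Ux; apply: near_eq_differentiable.
by near=> y; apply: fg; rewrite inE; near: y; exact: open_nbhs_nbhs.
Unshelve. all: by end_near. Qed.

(** The order is kept explicit because inverses and logarithms are handled by
    induction on it: the derivative of the inverse of [f] involves that inverse
    again, at the previous order. *)
Definition smooth_upto (n : nat) f : Prop :=
  forall s x, (size s <= n)%N -> U x -> differentiable (iterpd s f) x.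

Definition smooth f : Prop := forall s x, U x -> differentiable (iterpd s f) x.

Lemma smooth_uptoP f : smooth f <-> forall n, smooth_upto n f.
Proof. by split=> [sf n s x _|sf s x]; [exact: sf|exact: (sf (size s))]. Qed.

Lemma smooth_upto_eq n f g :
  {in U, f =1 g} -> smooth_upto n f -> smooth_upto n g.
Proof.
move=> fg sf s x sn Ux; apply: (@differentiable_eq (iterpd s f)) => //.
  exact: iterpd_eq.
exact: sf.
Qed.

Lemma smooth_uptoS n f : smooth_upto n.+1 f <->
  (forall x, U x -> differentiable f x) /\ (forall i, smooth_upto n (pd i f)).
Proof.
split=> [sf|[sf sdf]].
  split=> [x Ux|i s x sn Ux]; first exact: (sf [::]).
  by rewrite -iterpd_rcons; apply: sf; rewrite ?size_rcons.
elim/last_ind => [x _|s i _ x]; first exact: sf.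
by rewrite size_rcons iterpd_rcons ltnS; exact: sdf.
Qed.

Lemma smooth_upto_diff n f x : smooth_upto n f -> U x -> differentiable f x.
Proof. by move=> sf; exact: (sf [::]). Qed.

Lemma smooth_uptoW n f : smooth_upto n.+1 f -> smooth_upto n f.
Proof. by move=> sf s x sn; apply: sf; exact: leqW. Qed.

(** The induction step of all the closure properties below: the partial
    derivatives only need to be known on [U]. *)
Lemma smooth_uptoS_eq n f (df : 'I_m -> E -> R) :
  (forall x, U x -> differentiable f x) ->
  (forall i, {in U, pd i f =1 df i}) -> (forall i, smooth_upto n (df i)) ->
  smooth_upto n.+1 f.
Proof.
move=> sf dfE sdf; apply/smooth_uptoS; split=> // i.
by apply: smooth_upto_eq (sdf i) => x Ux; rewrite dfE.
Qed.

Lemma smooth_upto0 f : (forall x, U x -> differentiable f x) -> smooth_upto 0 f.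
Proof. by move=> sf [|//] x _; exact: sf. Qed.

Lemma smooth_upto_cst n (a : R) : smooth_upto n (fun=> a).
Proof.
elim: n a => [|n IHn] a.
  by apply: smooth_upto0 => x Ux; exact: differentiable_cst.
apply: (@smooth_uptoS_eq _ _ (fun _ _ => 0)) => // i x _.
exact: pd_cst.
Qed.

Lemma smooth_uptoD n f g : smooth_upto n f -> smooth_upto n g ->
  smooth_upto n (fun x => f x + g x).
Proof.
have diffD f' g' n' x : smooth_upto n' f' -> smooth_upto n' g' -> U x ->
    differentiable (fun x => f' x + g' x) x.
  by move=> sf sg Ux; apply: (@differentiableD _ _ _ f' g');
    apply: smooth_upto_diff Ux; eassumption.
elim: n f g => [|n IHn] f g sf sg.
  by apply: smooth_upto0 => x; exact: (diffD _ _ 0%N).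
have [df sdf] := (smooth_uptoS _ _).1 sf; have [dg sdg] := (smooth_uptoS _ _).1 sg.
apply: (@smooth_uptoS_eq _ _ (fun i x => pd i f x + pd i g x)) => [x|i x|i].
- exact: diffD sf sg.
- by rewrite inE => Ux; apply: pdD; [exact: df|exact: dg].
- exact: IHn.
Qed.

Lemma smooth_uptoM n f g : smooth_upto n f -> smooth_upto n g ->
  smooth_upto n (fun x => f x * g x).
Proof.
have diffM f' g' n' x : smooth_upto n' f' -> smooth_upto n' g' -> U x ->
    differentiable (fun x => f' x * g' x) x.
  by move=> sf sg Ux; apply: (@differentiableM _ _ f' g');
    apply: smooth_upto_diff Ux; eassumption.
elim: n f g => [|n IHn] f g sf sg.
  by apply: smooth_upto0 => x; exact: (diffM _ _ 0%N).
have [df sdf] := (smooth_uptoS _ _).1 sf; have [dg sdg] := (smooth_uptoS _ _).1 sg.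
apply: (@smooth_uptoS_eq _ _ (fun i x => pd i f x * g x + f x * pd i g x))
  => [x|i x|i].
- exact: diffM sf sg.
- by rewrite inE => Ux; apply: pdM; [exact: df|exact: dg].
- by apply: smooth_uptoD; apply: IHn => //; exact: smooth_uptoW.
Qed.

(** For [h] the inverse or the logarithm, [dh \o f] is a product of inverses of
    [f], to which the induction hypothesis at order [n] applies. *)
Lemma smooth_upto_comp1 n (h : R -> R) (dh : R -> R) f :
  (forall x, U x -> is_derive (f x) 1 h (dh (f x))) ->
  smooth_upto n.+1 f -> smooth_upto n (fun x => dh (f x)) ->
  smooth_upto n.+1 (fun x => h (f x)).
Proof.
move=> hdh sf sdh.
have [df sdf] := (smooth_uptoS _ _).1 sf.
have dh1 x : U x -> differentiable h (f x).
  by move=> /hdh [? _]; exact/derivable1_diffP.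
apply: (@smooth_uptoS_eq _ _ (fun i x => dh (f x) * pd i f x)) => [x Ux|i x|i].
- exact: (@differentiable_comp _ _ _ _ f h _ (df _ Ux) (dh1 _ Ux)).
- rewrite inE => Ux; rewrite /pd deriveE; last first.
    exact: (@differentiable_comp _ _ _ _ f h _ (df _ Ux) (dh1 _ Ux)).
  rewrite (@diff_comp _ _ _ _ f h _ (df _ Ux) (dh1 _ Ux))/=.
  rewrite (deriveE _ (df _ Ux)).
  have [hd hE] := hdh _ Ux.
  by rewrite deriv1E// derive1E hE mulrC.
- exact: smooth_uptoM.
Qed.

Lemma smooth_diff f x : smooth f -> U x -> differentiable f x.
Proof. by move=> sf; exact: (sf [::]). Qed.

Lemma smooth_eq f g : {in U, f =1 g} -> smooth f -> smooth g.
Proof.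
move=> fg /smooth_uptoP sf; apply/smooth_uptoP => n.
exact: smooth_upto_eq (sf n).
Qed.

Lemma smooth_pd i f : smooth f -> smooth (pd i f).
Proof. by move=> sf s x; rewrite -iterpd_rcons; exact: sf. Qed.

Lemma smooth_iterpd s f : smooth f -> smooth (iterpd s f).
Proof. by move=> sf t x; rewrite -iterpd_cat; exact: sf. Qed.

Lemma smooth_cst (a : R) : smooth (fun=> a).
Proof. by apply/smooth_uptoP => n; exact: smooth_upto_cst. Qed.

Lemma smoothD f g : smooth f -> smooth g -> smooth (fun x => f x + g x).
Proof.
move=> /smooth_uptoP sf /smooth_uptoP sg; apply/smooth_uptoP => n.
exact: smooth_uptoD.
Qed.

Lemma smoothM f g : smooth f -> smooth g -> smooth (fun x => f x * g x).
Proof.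
move=> /smooth_uptoP sf /smooth_uptoP sg; apply/smooth_uptoP => n.
exact: smooth_uptoM.
Qed.

Lemma smoothN f : smooth f -> smooth (fun x => - f x).
Proof.
move=> sf; apply: (@smooth_eq (fun x => -1 * f x)); last first.
  exact: smoothM (smooth_cst _) sf.
by move=> x _; rewrite mulN1r.
Qed.

Lemma smoothB f g : smooth f -> smooth g -> smooth (fun x => f x - g x).
Proof. by move=> sf sg; exact: smoothD sf (smoothN sg). Qed.

Lemma smooth_sum (J : Type) (r : seq J) (P : pred J) (F : J -> E -> R) :
  (forall j, P j -> smooth (F j)) -> smooth (fun x => \sum_(j <- r | P j) F j x).
Proof.
move=> sF; elim: r => [|j r IHr].
  by apply: smooth_eq (smooth_cst 0) => x _; rewrite big_nil.
have [Pj|/negbTE Pj] := boolP (P j).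
  apply: smooth_eq (smoothD (sF j Pj) IHr) => x _.
  by rewrite big_cons Pj.
by apply: smooth_eq IHr => x _; rewrite big_cons Pj.
Qed.

Lemma smooth_prod (J : Type) (r : seq J) (P : pred J) (F : J -> E -> R) :
  (forall j, P j -> smooth (F j)) ->
  smooth (fun x => \prod_(j <- r | P j) F j x).
Proof.
move=> sF; elim: r => [|j r IHr].
  by apply: smooth_eq (smooth_cst 1) => x _; rewrite big_nil.
have [Pj|/negbTE Pj] := boolP (P j).
  apply: smooth_eq (smoothM (sF j Pj) IHr) => x _.
  by rewrite big_cons Pj.
by apply: smooth_eq IHr => x _; rewrite big_cons Pj.
Qed.

Lemma smooth_exp f n : smooth f -> smooth (fun x => f x ^+ n).
Proof.
move=> sf; elim: n => [|n IHn]; first exact: smooth_cst.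
by apply: smooth_eq (smoothM sf IHn) => x _; rewrite exprS.
Qed.

Lemma smoothV f : (forall x, U x -> f x != 0) -> smooth f ->
  smooth (fun x => (f x)^-1).
Proof.
move=> f0 /smooth_uptoP sf; apply/smooth_uptoP; elim=> [|n IHn].
  apply: smooth_upto0 => x Ux.
  by apply: differentiableV (f0 _ Ux); exact: smooth_upto_diff (sf 0%N) Ux.
pose dh := fun y : R => -1 * (y^-1 * y^-1).
apply: (@smooth_upto_comp1 _ GRing.inv dh) => // [x Ux|].
- have /differentiable_Rinv/derivable1_diffP dfx := f0 _ Ux.
  apply: DeriveDef; first exact: dfx.
  rewrite (@deriveV _ _ id)//; last exact: f0.
  by rewrite derive_id /dh mulN1r -invfM -expr2 [_ *: _]mulr1.
- by apply: smooth_uptoM; [exact: smooth_upto_cst|exact: smooth_uptoM].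
Qed.

Lemma smooth_ln f : (forall x, U x -> 0 < f x) -> smooth f ->
  smooth (fun x => ln (f x)).
Proof.
move=> f0 sf; apply/smooth_uptoP => n.
apply/smooth_uptoW/(@smooth_upto_comp1 _ (@ln R) GRing.inv).
- by move=> x /f0 ?; exact: is_derive1_ln.
- exact: (smooth_uptoP _).1 sf _.
- by apply: (smooth_uptoP _).1; apply: smoothV => // x /f0; exact: lt0r_neq0.
Qed.

Lemma differentiable_coordB (l : 'I_m) (a : R) x :
  differentiable (fun y : E => y ord0 l - a) x.
Proof.
apply: (@differentiableB _ _ _ (fun y : E => y ord0 l) (cst a)) => //.
exact: differentiable_coord.
Qed.

Lemma pd_coordB i l (a : R) x : pd i (fun y => y ord0 l - a) x = (i == l)%:R.
Proof.
have dx : differentiable (fun y : E => y ord0 l) x by exact: differentiable_coord.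
rewrite pdD// pd_cst addr0 /pd deriveE//.
have lin : linear (fun y : E => y ord0 l : R^o) by move=> k y z; rewrite !mxE.
pose L : {linear E -> R^o} := HB.pack (fun y : E => y ord0 l : R^o)
  (GRing.isLinear.Build _ _ _ _ _ lin).
have -> : 'd (fun y : E => y ord0 l) x = L :> (E -> R).
  apply: (@diff_lin _ _ _ L) => y.
  by apply: differentiable_continuous; exact: differentiable_coord.
by rewrite /L/= mxE eqxx eq_sym.
Qed.

Lemma smooth_coordB (l : 'I_m) (a : R) : smooth (fun x => x ord0 l - a).
Proof.
apply/smooth_uptoP => n; apply: smooth_uptoW.
apply: (@smooth_uptoS_eq _ _ (fun i _ => (i == l)%:R)) => [x _|i x _|i].
- exact: differentiable_coordB.
- exact: pd_coordB.
- exact: smooth_upto_cst.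
Qed.

End SmoothFunctions.

(** * Symmetry of second derivatives *)

Section Schwarz.
Context {R : realType} {m : nat}.
Local Notation E := 'rV[R]_m.
Implicit Types (f g : E -> R) (x v : E).

Lemma open_normP (U : set E) x : open U -> U x ->
  exists2 r : R, 0 < r & forall h, `|h| < r -> U (x + h).
Proof.
move=> oU Ux; have /nbhs_normP[r r0 rU] := open_nbhs_nbhs (conj oU Ux).
by exists r => // h hr; apply: rU; rewrite /ball_/= opprD addNKr normrN.
Qed.

Lemma diff_bound f x (e : R) : differentiable f x -> 0 < e ->
  exists2 r : R, 0 < r &
    forall h, `|h| < r -> `|f (x + h) - f x - 'd f x h| <= e * `|h|.
Proof.
move=> df e0; have /eqaddoP/(_ e e0) := diff_locally df.
move=> /nbhs_normP[r r0 rP]; exists r => // h hr.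
have := rP h; rewrite /ball_/= sub0r normrN => /(_ hr).
by rewrite -!addrA -opprD [x + h]addrC.
Qed.

Lemma is_derive_line f a v (u : R) : derivable f (a + u *: v) v ->
  is_derive u 1 (fun t : R => f (a + t *: v)) ('D_v f (a + u *: v)).
Proof.
move=> df.
have E1 : (fun h : R => h^-1 *: (((fun t : R => f (a + t *: v)) \o shift u) (h *: 1)
             - f (a + u *: v))) =
         (fun h : R => h^-1 *: ((f \o shift (a + u *: v)) (h *: v) - f (a + u *: v))).
  apply/funext => h /=; congr (_ *: (f _ - _)).
  by rewrite [h *: 1]mulr1 scalerDl addrCA.
by apply: DeriveDef; [rewrite /derivable E1|rewrite /derive E1].
Qed.

Lemma norm_delta_mx (i : 'I_m) : `|delta_mx ord0 i : E| <= 1.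
Proof.
rewrite [leLHS]/Num.Def.normr/= mx_normrE.
apply/bigmax_leP; split=> // -[j k] _ /=; rewrite mxE.
by case: (_ && _); rewrite ?normr1 ?normr0.
Qed.

Lemma diff_pd f x i (t : R) : differentiable f x ->
  'd f x (t *: delta_mx ord0 i) = t * pd i f x.
Proof. by move=> df; rewrite linearZ /pd deriveE. Qed.

Lemma ler_dist_sum (A B p a b c d : R) :
  `|A - p - (a + b)| <= c -> `|B - p - a| <= d -> `|A - B - b| <= c + d.
Proof.
move=> Ac Bd; apply: le_trans (lerD Ac Bd); apply: le_trans (ler_normB _ _).
by rewrite le_eqVlt; apply/orP; left; apply/eqP; congr `|_|; ring.
Qed.

Lemma ler_dist_swap (p q r u a b c d : R) :
  `|p - q - (r - u) - a| <= c -> `|p - r - (q - u) - b| <= d ->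
  `|b - a| <= c + d.
Proof.
move=> pc pd; apply: le_trans (lerD pc pd); apply: le_trans (ler_normB _ _).
by rewrite le_eqVlt; apply/orP; left; apply/eqP; congr `|_|; ring.
Qed.

Variables (U : set E) (oU : open U).

(** By the mean value theorem in direction [i], the second difference over the
    parallelogram with sides [t e_i] and [t e_j] is [t] times an increment of the
    [i]-th partial derivative in direction [j], which differentiability of the
    latter evaluates. *)
Lemma second_difference f x i j (e : R) : smooth U f -> U x -> 0 < e ->
  exists2 r : R, 0 < r & forall t, 0 < t < r ->
    let ei := t *: delta_mx ord0 i in let ej := t *: delta_mx ord0 j in
    `|f (x + ei + ej) - f (x + ei) - (f (x + ej) - f x)
       - t ^+ 2 * pd j (pd i f) x| <= e * t ^+ 2.
Proof.
move=> sf Ux e0.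
have [r1 r10 r1U] := open_normP oU Ux.
have dif : differentiable (pd i f) x by exact: smooth_diff (smooth_pd _ sf) Ux.
have e40 : 0 < e / 3 by rewrite divr_gt0.
have [r2 r20 dfb] := diff_bound dif e40.
have r0 : 0 < Num.min r1 r2 by rewrite lt_min r10.
exists (Num.min r1 r2 / 2); first by rewrite divr_gt0.
move=> t /andP[t0 tr].
have [tr1 tr2] : t + t < r1 /\ t + t < r2.
  by move: tr; rewrite ltr_pdivlMr// mulr_natr mulr2n lt_min => /andP[].
have dn k (u : R) : 0 <= u -> u <= t -> `|u *: delta_mx ord0 k : E| <= t.
  move=> u0 ut; rewrite normrZ ger0_norm//.
  by rewrite (le_trans _ ut)// ler_piMr// norm_delta_mx.
have dn2 (u : R) : 0 <= u -> u <= t ->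
    `|u *: delta_mx ord0 i + t *: delta_mx ord0 j : E| <= t + t.
  move=> u0 ut; rewrite (le_trans (ler_normD _ _))// lerD// dn// ltW//.
have U1 (u : R) : 0 <= u -> u <= t -> U (x + u *: delta_mx ord0 i).
  by move=> u0 ut; apply: r1U; apply: le_lt_trans (dn _ _ u0 ut) _; lra.
have U2 (u : R) : 0 <= u -> u <= t ->
    U (x + t *: delta_mx ord0 j + u *: delta_mx ord0 i).
  move=> u0 ut; rewrite -addrA [_ *: _ + _ *: _]addrC.
  by apply: r1U; apply: le_lt_trans (dn2 _ u0 ut) _; lra.
set ei := t *: _; set ej := t *: delta_mx ord0 j => /=.
pose phi (u : R) := f (x + ej + u *: delta_mx ord0 i) - f (x + u *: delta_mx ord0 i).
pose dphi (u : R) := pd i f (x + ej + u *: delta_mx ord0 i)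
                     - pd i f (x + u *: delta_mx ord0 i).
have dphiP (u : R) : 0 <= u -> u <= t -> is_derive u 1 phi (dphi u).
  move=> u0 ut; apply: is_deriveB; apply: is_derive_line; apply: diff_derivable;
    apply: smooth_diff sf _; [exact: U2|exact: U1].
have [||u /[!in_itv]/=/andP[u0 ut] E1] := @MVT R phi dphi 0 t t0.
- by move=> u /[!in_itv]/=/andP[u0 ut]; apply: dphiP; exact: ltW.
- apply: derivable_within_continuous => u /[!in_itv]/=/andP[u0 ut].
  by have [] := dphiP u u0 ut.
have -> : f (x + ei + ej) - f (x + ei) - (f (x + ej) - f x) = phi t - phi 0.
  by rewrite /phi !scale0r !addr0 [x + ej + _]addrAC.
rewrite E1 subr0 {E1}.
pose e1 : E := u *: delta_mx ord0 i.
have n1 : `|e1| <= t by rewrite dn// ltW.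
have n2 : `|e1 + ej| <= t + t by rewrite dn2// ltW.
have b1 := dfb e1 (le_lt_trans n1 (lt_trans _ tr2)).
have {}b1 : `|pd i f (x + e1) - pd i f x - 'd (pd i f) x e1| <= e / 3 * t.
  apply: le_trans (b1 _) _; first by rewrite ltrDl.
  by rewrite ler_pM2l.
have {dfb} b2 := dfb (e1 + ej) (le_lt_trans n2 tr2).
have {}b2 : `|pd i f (x + (e1 + ej)) - pd i f x - 'd (pd i f) x (e1 + ej)| <=
    e / 3 * (t + t).
  by apply: le_trans b2 _; rewrite ler_pM2l.
have dj : 'd (pd i f) x ej = t * pd j (pd i f) x := diff_pd j t dif.
rewrite linearD/= dj in b2.
have dphiE : dphi u = pd i f (x + (e1 + ej)) - pd i f (x + e1).
  by rewrite /dphi -/e1 addrAC addrA.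
have : `|dphi u - t * pd j (pd i f) x| <= e * t.
  rewrite dphiE (_ : e * t = e / 3 * (t + t) + e / 3 * t); last by field.
  exact: ler_dist_sum b2 b1.
have -> : dphi u * t - t ^+ 2 * pd j (pd i f) x =
    (dphi u - t * pd j (pd i f) x) * t by ring.
by rewrite normrM (gtr0_norm t0) expr2 mulrA ler_pM2r.
Qed.

(** The second difference is symmetric in [i] and [j]. *)
Lemma pdC i j f : smooth U f -> {in U, pd i (pd j f) =1 pd j (pd i f)}.
Proof.
move=> sf x; rewrite inE => Ux; apply/eqP; rewrite -subr_eq0 -normr_le0.
apply/ler_addgt0Pr => e e0; rewrite add0r.
have e20 : 0 < e / 2 by rewrite divr_gt0.
have [r1 r10 b1] := second_difference i j sf Ux e20.
have [r2 r20 b2] := second_difference j i sf Ux e20.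
have r0 : 0 < Num.min r1 r2 by rewrite lt_min r10.
pose t := Num.min r1 r2 / 2.
have t0 : 0 < t by rewrite divr_gt0.
have [tr1 tr2] : t < r1 /\ t < r2.
  by apply/andP; rewrite -lt_min ltr_pdivrMr// mulr_natr mulr2n ltrDl.
have {b1} := b1 t; have {b2} := b2 t; rewrite t0 tr1 tr2/= => /(_ isT) b2 /(_ isT) b1.
rewrite [x + t *: delta_mx ord0 j + _]addrAC in b2.
have : `|t ^+ 2 * (pd i (pd j f) x - pd j (pd i f) x)| <= e * t ^+ 2.
  rewrite (_ : e * t ^+ 2 = e / 2 * t ^+ 2 + e / 2 * t ^+ 2); last by field.
  rewrite mulrBr; apply: ler_dist_swap b1 b2.
have t20 : 0 < t ^+ 2 by rewrite exprn_gt0.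
by rewrite normrM (gtr0_norm t20) mulrC ler_pM2r.
Qed.

Lemma iterpd_perm s t f : smooth U f -> perm_eq s t ->
  {in U, iterpd s f =1 iterpd t f}.
Proof.
move=> sf; have move_front a t1 t2 : {in U, iterpd (t1 ++ a :: t2) f =1
    iterpd (a :: t1 ++ t2) f}.
  elim: t1 => [//|b t1 IHt] x Ux.
  apply: etrans (pd_eq oU b IHt Ux) _.
  exact: (pdC b a (smooth_iterpd (t1 ++ t2) sf) Ux).
elim: s t => [|a s IHs] t st x Ux.
  by move: st; rewrite perm_sym => /perm_nilP ->.
have /path.splitPr at_ : a \in t by rewrite -(perm_mem st) mem_head.
case: at_ st => t1 t2.
rewrite perm_sym perm_catC/= perm_cons => st.
apply: etrans (esym (move_front a t1 t2 x Ux)).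
apply: (pd_eq oU _ _ Ux) => y Uy; apply: IHs Uy.
by rewrite perm_sym perm_catC.
Qed.

End Schwarz.

(** * Jets at a point *)

Section Jets.
Context {R : realType} {m : nat}.
Local Notation E := 'rV[R]_m.
Local Notation multi := (@multi m).
Implicit Types (f g h : E -> R) (s t : seq 'I_m) (x : E) (i j : multi).

Variables (U : set E) (oU : open U).

Lemma iterpdD s f g : smooth U f -> smooth U g ->
  {in U, iterpd s (fun x => f x + g x) =1 fun x => iterpd s f x + iterpd s g x}.
Proof.
move=> sf sg; elim: s => [//|l s IHs] x Ux.
apply: etrans (pd_eq oU l IHs Ux) _; apply: pdD.
- by apply: sf; exact: set_mem.
- by apply: sg; exact: set_mem.
Qed.

Lemma iterpdN s f : smooth U f ->
  {in U, iterpd s (fun x => - f x) =1 fun x => - iterpd s f x}.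
Proof.
move=> sf; elim: s => [//|l s IHs] x Ux.
apply: etrans (pd_eq oU l IHs Ux) _; apply: pdN.
by apply: sf; exact: set_mem.
Qed.

Lemma iterpdZ s (c : R) f : smooth U f ->
  {in U, iterpd s (fun x => c * f x) =1 fun x => c * iterpd s f x}.
Proof.
move=> sf; elim: s => [//|l s IHs] x Ux.
apply: etrans (pd_eq oU l IHs Ux) _.
rewrite pdM ?pd_cst ?mul0r ?add0r//.
by apply: sf; exact: set_mem.
Qed.

Lemma iterpd0 s x : iterpd s (fun=> 0 : R) x = 0.
Proof.
have -> : iterpd s (fun=> 0 : R) = (fun _ : E => 0).
  by elim: s => [//|l s /= ->]; apply/funext => y; rewrite pd_cst.
by [].
Qed.

Lemma iterpd_sum s n (F : 'I_n -> E -> R) : (forall k, smooth U (F k)) ->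
  {in U, iterpd s (fun x => \sum_k F k x) =1 fun x => \sum_k iterpd s (F k) x}.
Proof.
elim: n F => [|n IHn] F sF x Ux.
  by under eq_fun do rewrite big_ord0; rewrite big_ord0 iterpd0.
under eq_fun do rewrite big_ord_recl.
rewrite big_ord_recl iterpdD ?IHn//; last by apply: smooth_sum.
Qed.

Variables (x0 : E) (Ux0 : U x0).

Let Ux0' : x0 \in U. Proof. exact: mem_set. Qed.

(** [f] is [O(|x - x0| ^ n)]. Quantifying over all sequences of derivations,
    rather than over multi-indices, makes the product rule apply directly. *)
Definition vanish (n : nat) f : Prop :=
  forall s, (size s < n)%N -> iterpd s f x0 = 0.

Lemma vanish_le n p f : (n <= p)%N -> vanish p f -> vanish n f.
Proof. by move=> np vf s sn; apply: vf; exact: leq_trans np. Qed.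

Lemma vanish_eq n f g : {in U, f =1 g} -> vanish n f -> vanish n g.
Proof. by move=> fg vf s sn; rewrite -(iterpd_eq oU s fg Ux0') vf. Qed.

Lemma vanish_zero n : vanish n (fun=> 0).
Proof. by move=> s _; exact: iterpd0. Qed.

Lemma vanish1 f : f x0 = 0 -> vanish 1 f.
Proof. by move=> f0 [|//] _. Qed.

Lemma vanishS n f : f x0 = 0 -> (forall l, vanish n (pd l f)) -> vanish n.+1 f.
Proof.
move=> f0 df; elim/last_ind => [//|s l _].
by rewrite size_rcons ltnS iterpd_rcons; exact: df.
Qed.

Lemma vanish_pd n l f : vanish n f -> vanish n.-1 (pd l f).
Proof.
move=> vf s sn; rewrite -iterpd_rcons; apply: vf.
by rewrite size_rcons; move: sn; case: n .
Qed.

Lemma vanishD n f g : smooth U f -> smooth U g ->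
  vanish n f -> vanish n g -> vanish n (fun x => f x + g x).
Proof. by move=> sf sg vf vg s sn; rewrite iterpdD// vf// vg// addr0. Qed.

Lemma vanishN n f : smooth U f -> vanish n f -> vanish n (fun x => - f x).
Proof. by move=> sf vf s sn; rewrite iterpdN// vf// oppr0. Qed.

(** Leibniz: each derivative of a product lowers the order of only one factor. *)
Lemma vanishM n p f g : smooth U f -> smooth U g ->
  vanish n f -> vanish p g -> vanish (n + p) (fun x => f x * g x).
Proof.
move=> sf sg vf vg s; move: n p f g sf sg vf vg.
elim/last_ind: s => [n p f g _ _ vf vg|s l IHs n p f g sf sg vf vg].
  case: n vf => [_|n vf _]; last by rewrite /= [f x0](vf [::])// mul0r.
  case: p vg => [//|p vg _]; by rewrite /= [g x0](vg [::])// mulr0.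
rewrite size_rcons iterpd_rcons => snp.
have sdf := smooth_pd l sf; have sdg := smooth_pd l sg.
have dfg : {in U, pd l (fun x => f x * g x) =1
    fun x => pd l f x * g x + f x * pd l g x}.
  by move=> x /set_mem Ux; apply: pdM; exact: smooth_diff Ux.
rewrite (iterpd_eq oU s dfg Ux0') iterpdD; [|exact: smoothM|exact: smoothM|by []].
rewrite (IHs _ _ _ _ sdf sg (vanish_pd l vf) vg); last first.
  case: n vf snp => [_|n _]; rewrite ?addSn//=; exact: ltnW.
rewrite (IHs _ _ _ _ sf sdg vf (vanish_pd l vg)) ?addr0//.
by case: p vg snp => [_|p _]; rewrite ?addnS// !addn0; exact: ltnW.
Qed.

(** Equality of the jets of order [n - 1] at [x0]. Smoothness is part of the
    relation so that it is carried along by the congruence rules. *)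
Definition jet_eq n f g : Prop :=
  [/\ smooth U f, smooth U g & vanish n (fun x => f x - g x)].

Lemma jet_eq_refl n f : smooth U f -> jet_eq n f f.
Proof.
move=> sf; split=> //.
by apply: (vanish_eq _ (@vanish_zero n)) => x _; rewrite subrr.
Qed.

Lemma jet_eq_le n p f g : (n <= p)%N -> jet_eq p f g -> jet_eq n f g.
Proof. by move=> np [sf sg]; split=> //; exact: vanish_le np _. Qed.

Lemma jet_eqD n f f' g g' : jet_eq n f f' -> jet_eq n g g' ->
  jet_eq n (fun x => f x + g x) (fun x => f' x + g' x).
Proof.
move=> [sf sf' vf] [sg sg' vg]; split; [exact: smoothD|exact: smoothD|].
apply: (vanish_eq _ (vanishD _ _ vf vg)); [|exact: smoothB|exact: smoothB].
by move=> x _; rewrite opprD addrACA.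
Qed.

Lemma jet_eqN n f f' : jet_eq n f f' ->
  jet_eq n (fun x => - f x) (fun x => - f' x).
Proof.
move=> [sf sf' vf]; split; [exact: smoothN|exact: smoothN|].
apply: (vanish_eq _ (vanishN _ vf)); last exact: smoothB.
by move=> x _; rewrite opprD.
Qed.

Lemma jet_eqB n f f' g g' : jet_eq n f f' -> jet_eq n g g' ->
  jet_eq n (fun x => f x - g x) (fun x => f' x - g' x).
Proof. by move=> ff' gg'; exact: jet_eqD ff' (jet_eqN gg'). Qed.

Lemma jet_eqM n f f' g g' : jet_eq n f f' -> jet_eq n g g' ->
  jet_eq n (fun x => f x * g x) (fun x => f' x * g' x).
Proof.
move=> [sf sf' vf] [sg sg' vg]; split; [exact: smoothM|exact: smoothM|].
have v0 h : vanish 0 h by [].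
have v1 := vanishM (smoothB oU sf sf') sg vf (v0 g).
have v2 := vanishM sf' (smoothB oU sg sg') (v0 f') vg.
rewrite addn0 in v1.
apply: (vanish_eq _ (vanishD _ _ v1 v2)); first by move=> x _; ring.
- by apply: smoothM => //; exact: smoothB.
- by apply: smoothM => //; exact: smoothB.
Qed.

(** A factor vanishing at [x0] gains one order on the difference of the other
    ones: this is what makes the system for the coefficients triangular. *)
Lemma jet_eqM1 n f f' g g' : vanish 1 f -> vanish 1 g' ->
  jet_eq n f f' -> jet_eq n g g' ->
  jet_eq n.+1 (fun x => f x * g x) (fun x => f' x * g' x).
Proof.
move=> f0 g0 [sf sf' vf] [sg sg' vg]; split; [exact: smoothM|exact: smoothM|].
have v1 := vanishM sf (smoothB oU sg sg') f0 vg.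
have v2 := vanishM (smoothB oU sf sf') sg' vf g0.
rewrite addn1 in v2.
apply: (vanish_eq _ (vanishD _ _ v1 v2)); first by move=> x _; ring.
- by apply: smoothM => //; exact: smoothB.
- by apply: smoothM => //; exact: smoothB.
Qed.

(** Here the order missing for [f' * g'] is provided by the precision to which
    the first factor is known, since [g'] may be nonzero at [x0]. *)
Lemma jet_eqM1l n f f' g g' : vanish 1 f -> jet_eq n.+1 f f' -> jet_eq n g g' ->
  jet_eq n.+1 (fun x => f x * g x) (fun x => f' x * g' x).
Proof.
move=> f0 [sf sf' vf] [sg sg' vg]; split; [exact: smoothM|exact: smoothM|].
have v1 := vanishM sf (smoothB oU sg sg') f0 vg.
have v0 : vanish 0 g' by [].
have v2 := vanishM (smoothB oU sf sf') sg' vf v0.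
rewrite addn0 in v2.
apply: (vanish_eq _ (vanishD _ _ v1 v2)); first by move=> x _; ring.
- by apply: smoothM => //; exact: smoothB.
- by apply: smoothM => //; exact: smoothB.
Qed.

Lemma jet_eq_at0 n f g : jet_eq n.+1 f g -> f x0 = g x0.
Proof. by move=> [_ _ v]; apply/eqP; rewrite -subr_eq0; apply/eqP/(v [::]). Qed.

Lemma jet_eq_sum n (J : Type) (r : seq J) (P : pred J) (F F' : J -> E -> R) :
  (forall k, P k -> jet_eq n (F k) (F' k)) ->
  jet_eq n (fun x => \sum_(k <- r | P k) F k x)
           (fun x => \sum_(k <- r | P k) F' k x).
Proof.
move=> FF'; elim: r => [|k r IHr].
  rewrite (_ : (fun x => _) = fun=> 0); last by apply/funext=> x; rewrite big_nil.
  rewrite (_ : (fun x => _) = fun=> 0); last by apply/funext=> x; rewrite big_nil.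
  exact/jet_eq_refl/smooth_cst.
have [Pk|/negbTE Pk] := boolP (P k); last first.
  by under eq_fun do rewrite big_cons Pk;
     under [in X in jet_eq _ _ X]eq_fun do rewrite big_cons Pk.
under eq_fun do rewrite big_cons Pk.
under [in X in jet_eq _ _ X]eq_fun do rewrite big_cons Pk.
exact: jet_eqD (FF' k Pk) IHr.
Qed.

Lemma jet_eq_pd n l f f' : jet_eq n.+1 f f' -> jet_eq n (pd l f) (pd l f').
Proof.
move=> [sf sf' vf]; split; [exact: smooth_pd|exact: smooth_pd|].
apply: (vanish_eq _ (vanish_pd l vf)) => x /set_mem Ux /=.
rewrite (pdD l (smooth_diff sf Ux)) ?pdN//; first exact: smooth_diff Ux.
by apply: smooth_diff Ux; exact: smoothN.
Qed.

Lemma jet_eq_trans n f g h : jet_eq n f g -> jet_eq n g h -> jet_eq n f h.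
Proof.
move=> [sf sg v1] [_ sh v2]; split=> //.
apply: (vanish_eq _ (vanishD _ _ v1 v2)); [|exact: smoothB|exact: smoothB].
by move=> x _; rewrite addrA subrK.
Qed.

Lemma jet_eq_eq n f f' g g' : {in U, f =1 f'} -> {in U, g =1 g'} ->
  jet_eq n f g -> jet_eq n f' g'.
Proof.
move=> ff' gg' [sf sg v]; split; [exact: smooth_eq sf|exact: smooth_eq sg|].
by apply: (vanish_eq _ v) => x Ux /=; rewrite ff'// gg'.
Qed.

End Jets.

(** * Monomials and Taylor polynomials *)

Section Taylor.
Context {R : realType} {m : nat}.
Local Notation E := 'rV[R]_m.
Local Notation multi := (@multi m).
Implicit Types (f g h : E -> R) (s t : seq 'I_m) (x : E) (i j : multi).

Definition counts s : multi := [ffun l => count_mem l s].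

(** The sequence of derivations that [taylor_coef] applies. *)
Definition multi_seq i : seq 'I_m := flatten [seq nseq (i l) l | l <- enum 'I_m].

Definition multi_fact i : nat := (\prod_(l < m) (i l)`!)%N.

Lemma counts_multi_seq i : counts (multi_seq i) = i.
Proof.
apply/ffunP => l; rewrite ffunE count_flatten -map_comp sumnE big_map big_enum/=.
rewrite (bigD1 l)//= count_nseq /= eqxx mul1n big1 ?addn0// => k kl.
by rewrite count_nseq/= (negbTE kl).
Qed.

Lemma tr_counts s : tr (counts s) = size s.
Proof.
rewrite /tr; under eq_bigr do rewrite ffunE.
elim: s => [|a s IHs]/=; first by rewrite big1.
by rewrite big_split/= IHs (bigD1 a)//= eqxx big1 // => l /negbTE; rewrite eq_sym => ->.
Qed.

Lemma size_multi_seq i : size (multi_seq i) = tr i.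
Proof. by rewrite -tr_counts counts_multi_seq. Qed.

Lemma perm_multi_seq s : perm_eq s (multi_seq (counts s)).
Proof.
apply/allP => l _ /=; have /ffunP/(_ l) := counts_multi_seq (counts s).
by rewrite !ffunE => ->.
Qed.

Lemma multi_fact_neq0 i : (multi_fact i)%:R != 0 :> R.
Proof.
rewrite pnatr_eq0 -lt0n; apply/prodn_gt0 => l; exact: fact_gt0.
Qed.

Lemma smooth_monomial (U : set E) (oU : open U) (x0 : E) i :
  smooth U (monomial x0 i).
Proof.
by apply: smooth_prod => // l _; apply: smooth_exp => //; exact: smooth_coordB.
Qed.

Lemma smooth_tpoly (U : set E) (oU : open U) n (x0 : E) (g : multi -> R) :
  smooth U (tpoly n x0 g).
Proof.
apply: smooth_sum => // i _; apply: smoothM => //; first exact: smooth_cst.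
exact: smooth_monomial.
Qed.

Section Monomials.
Variable x0 : E.

Lemma pd_coord_exp l k n x :
  pd l (fun y => (y ord0 k - x0 ord0 k) ^+ n) x =
  (l == k)%:R * n%:R * (x ord0 k - x0 ord0 k) ^+ n.-1.
Proof.
have sc : smooth setT (fun y : E => y ord0 k - x0 ord0 k).
  by apply: smooth_coordB; exact: openT.
elim: n => [|n IHn]; first by rewrite pd_cst mulr0 mul0r.
have -> : (fun y : E => (y ord0 k - x0 ord0 k) ^+ n.+1) =
    (fun y => (y ord0 k - x0 ord0 k) * (y ord0 k - x0 ord0 k) ^+ n).
  by apply/funext => y; rewrite exprS.
rewrite pdM; last 2 first.
- exact: smooth_diff sc _.
- by apply: smooth_diff (I : setT x); apply: smooth_exp => //; exact: openT.
rewrite IHn pd_coordB/= -[n.+1]addn1 natrD; case: n {IHn} => [|n].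
  by rewrite expr0; ring.
by rewrite /= exprS; ring.
Qed.

Lemma pd_prod_eq0 l (r : seq 'I_m) (P : pred 'I_m) (F : 'I_m -> E -> R) x :
  (forall k, smooth setT (F k)) -> (forall k, P k -> pd l (F k) x = 0) ->
  pd l (fun y => \prod_(k <- r | P k) F k y) x = 0.
Proof.
move=> sF dF; elim: r => [|k r IHr].
  by under eq_fun do rewrite big_nil; rewrite pd_cst.
have [Pk|/negbTE Pk] := boolP (P k); last first.
  by under eq_fun do rewrite big_cons Pk.
under eq_fun do rewrite big_cons Pk.
rewrite pdM; last 2 first.
- exact: smooth_diff (sF k) _.
- by apply: smooth_diff (I : setT x); apply: smooth_prod => //; exact: openT.
by rewrite IHr dF// mul0r mulr0 addr0.
Qed.

Lemma pd_monomial l i x : pd l (monomial x0 i) x =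
  (i l)%:R * monomial x0 [ffun k => (i k - (k == l))%N] x.
Proof.
have sc k n : smooth setT (fun y : E => (y ord0 k - x0 ord0 k) ^+ n).
  by apply: smooth_exp; [|apply: smooth_coordB]; exact: openT.
have -> : monomial x0 i = (fun y => (y ord0 l - x0 ord0 l) ^+ i l *
    \prod_(k < m | k != l) (y ord0 k - x0 ord0 k) ^+ i k).
  by apply/funext => y; rewrite /monomial (bigD1 l).
rewrite pdM; last 2 first.
- exact: smooth_diff (sc l (i l)) _.
- by apply: smooth_diff (I : setT x); apply: smooth_prod => //; exact: openT.
rewrite pd_coord_exp eqxx mul1r pd_prod_eq0 => [||k kl]; last 2 first.
- by move=> k; exact: sc.
- by rewrite pd_coord_exp eq_sym (negbTE kl) !mul0r.
rewrite mulr0 addr0 -mulrA /monomial [in RHS](bigD1 l)//= ffunE eqxx subn1.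
congr (_ * (_ * _)); apply: eq_bigr => k kl.
by rewrite ffunE (negbTE kl) subn0.
Qed.

Lemma iterpd_monomial s i x : iterpd s (monomial x0 i) x =
  (\prod_(l < m) (i l) ^_ (count_mem l s))%:R *
  monomial x0 [ffun l => (i l - count_mem l s)%N] x.
Proof.
elim: s x => [|k s IHs] x /=.
  rewrite big1 ?mul1r; last by move=> l _; rewrite ffactn0.
  by congr monomial; apply/ffunP => l; rewrite ffunE subn0.
have -> : pd k (iterpd s (monomial x0 i)) x = pd k (fun x =>
    (\prod_(l < m) (i l) ^_ (count_mem l s))%:R *
    monomial x0 [ffun l => (i l - count_mem l s)%N] x) x.
  by congr pd; exact/funext.
rewrite pdM; [|exact: differentiable_cst|]; last first.
  by apply: smooth_diff (I : setT x); apply: smooth_monomial; exact: openT.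
rewrite pd_cst mul0r add0r pd_monomial mulrA -natrM ffunE; congr (_%:R * _).
  rewrite (bigD1 k)//= [RHS](bigD1 k)//= eqxx add1n ffactnSr mulnAC.
  congr (_ * _)%N; apply: eq_bigr => l lk.
  by rewrite eq_sym (negbTE lk).
congr monomial; apply/ffunP => l; rewrite !ffunE -subnDA addnC.
by rewrite [k == l]eq_sym.
Qed.

Lemma monomial_at0 i : monomial x0 i x0 = [forall l, i l == 0%N]%:R.
Proof.
have [/forallP i0|/forallPn[l il]] := boolP [forall l, i l == 0%N].
  by rewrite /monomial big1// => l _; rewrite (eqP (i0 l)) expr0.
by rewrite /monomial (bigD1 l)//= subrr expr0n (negbTE il) mul0r.
Qed.

Lemma iterpd_monomial0 s i :
  iterpd s (monomial x0 i) x0 = (i == counts s)%:R * (multi_fact i)%:R.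
Proof.
rewrite iterpd_monomial monomial_at0.
have [->|ics] := eqVneq i (counts s).
  rewrite mul1r (_ : [forall _, _] = true) ?mulr1.
    congr _%:R; apply: eq_bigr => l _; by rewrite ffunE ffactnn.
  by apply/forallP => l; rewrite !ffunE subnn.
rewrite mul0r.
case: forallP => [le|_]; last by rewrite mulr0.
have [l il] : exists l, i l != count_mem l s.
  apply/existsP; apply: contraNT ics => /existsPn ics.
  by apply/eqP/ffunP => l; have /negPn/eqP -> := ics l; rewrite ffunE.
rewrite (bigD1 l)//= ffact_small ?mul0n ?mul0r//.
by have := le l; rewrite ffunE subn_eq0 ltn_neqAle il.
Qed.

Lemma iterpd_sumZ (J : eqType) s (r : seq J) (c : J -> R) (F : J -> E -> R) x :
  (forall k, smooth setT (F k)) ->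
  iterpd s (fun y => \sum_(k <- r) c k * F k y) x =
  \sum_(k <- r) c k * iterpd s (F k) x.
Proof.
move=> sF; have xT : x \in [set: E] by rewrite inE.
have scF k : smooth setT (fun y => c k * F k y).
  by apply: smoothM => //; [exact: openT|exact: smooth_cst openT _].
have iZ k y : iterpd s (fun y => c k * F k y) y = c k * iterpd s (F k) y.
  elim: s y => [//|l s IHs] y /=.
  rewrite (_ : iterpd s (fun y => c k * F k y) = fun y => c k * iterpd s (F k) y);
    last exact/funext.
  rewrite pdM; [|exact: differentiable_cst|exact: sF].
  by rewrite pd_cst mul0r add0r.
elim: r => [|k r IHr].
  by under eq_fun do rewrite big_nil; rewrite big_nil iterpd0.
under eq_fun do rewrite big_cons.
rewrite big_cons (iterpdD openT) ?IHr ?iZ//.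
by apply: smooth_sum => //; exact: openT.
Qed.

Lemma sum_midx_pick n i (F : multi -> R) :
  \sum_(j <- midx n) F j * (j == i)%:R = (tr i <= n)%:R * F i.
Proof.
rewrite -mem_midx; have [iin|inotin] := boolP (i \in midx n).
  rewrite (bigD1_seq i)//= ?midx_uniq// eqxx mulr1 mul1r big1 ?addr0//.
  by move=> j /negbTE ->; rewrite mulr0.
rewrite mul0r big_seq big1// => j jin.
by case: eqVneq => [ji|_]; rewrite ?mulr0//; rewrite ji (negbTE inotin) in jin.
Qed.

Lemma iterpd_tpoly0 s n (g : multi -> R) : iterpd s (tpoly n x0 g) x0 =
  (size s <= n)%:R * (g (counts s) * (multi_fact (counts s))%:R).
Proof.
rewrite iterpd_sumZ; last by move=> j; apply: smooth_monomial; exact: openT.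
under eq_bigr => j _ do
  rewrite iterpd_monomial0 [_%:R * _]mulrC mulrA.
by rewrite sum_midx_pick tr_counts.
Qed.

Lemma taylor_coef_tpoly n (g : multi -> R) i :
  taylor_coef (tpoly n x0 g) x0 i = (tr i <= n)%:R * g i.
Proof.
rewrite /taylor_coef -/(multi_seq i) iterpd_tpoly0 counts_multi_seq size_multi_seq.
by rewrite mulrA mulfK// multi_fact_neq0.
Qed.

Lemma tpoly_euler n (g : multi -> R) x :
  \sum_(l < m) (x ord0 l - x0 ord0 l) * pd l (tpoly n x0 g) x =
  tpoly n x0 (fun i => (tr i)%:R * g i) x.
Proof.
have pdE l : pd l (tpoly n x0 g) x =
    \sum_(i <- midx n) g i * pd l (monomial x0 i) x.
  apply: (iterpd_sumZ [:: l]) => j; apply: smooth_monomial; exact: openT.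
under eq_bigr do rewrite pdE big_distrr/=.
rewrite exchange_big/=; apply: eq_bigr => i _.
rewrite /tr natr_sum !big_distrl/=; apply: eq_bigr => l _.
rewrite pd_monomial; set y := _ - _; set M' := monomial _ _ _.
suff yM : (i l)%:R * (y * M') = (i l)%:R * monomial x0 i x.
  by rewrite -[in RHS]mulrA [RHS]mulrCA -yM; ring.
have [il0|il0] := eqVneq (i l) 0%N; first by rewrite il0 !mul0r.
rewrite /M' /monomial (bigD1 l)//= [in RHS](bigD1 l)//= [y * _]mulrA ffunE eqxx subn1.
rewrite -exprS prednK ?lt0n//; congr (_ * (_ * _)).
by apply: eq_bigr => k kl; rewrite ffunE (negbTE kl) subn0.
Qed.

End Monomials.

Variables (U : set E) (oU : open U) (x0 : E) (Ux0 : U x0).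

(** Partial derivatives commute, so a jet is determined by the Taylor
    coefficients, which only record derivatives taken in increasing order of the
    coordinates. *)
Lemma iterpd_taylor s f : smooth U f ->
  iterpd s f x0 = taylor_coef f x0 (counts s) * (multi_fact (counts s))%:R.
Proof.
move=> sf; rewrite /taylor_coef divfK ?multi_fact_neq0//.
by rewrite (iterpd_perm oU sf (perm_multi_seq s))// inE.
Qed.

Lemma taylor_coef_vanish n f i : vanish x0 n f -> (tr i < n)%N ->
  taylor_coef f x0 i = 0.
Proof. by move=> vf in_; rewrite /taylor_coef vf ?mul0r// size_multi_seq. Qed.

Lemma vanish_taylor n f : smooth U f ->
  (forall i, (tr i < n)%N -> taylor_coef f x0 i = 0) -> vanish x0 n f.
Proof. by move=> sf f0 s sn; rewrite iterpd_taylor// f0 ?mul0r// tr_counts. Qed.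

Lemma taylor_coefD f g i : smooth U f -> smooth U g ->
  taylor_coef (fun x => f x + g x) x0 i = taylor_coef f x0 i + taylor_coef g x0 i.
Proof. by move=> sf sg; rewrite /taylor_coef (iterpdD oU _ sf sg) ?inE// mulrDl. Qed.

Lemma taylor_coefN f i : smooth U f ->
  taylor_coef (fun x => - f x) x0 i = - taylor_coef f x0 i.
Proof. by move=> sf; rewrite /taylor_coef (iterpdN oU _ sf) ?inE// mulNr. Qed.

Lemma taylor_coefZ (c : R) f i : smooth U f ->
  taylor_coef (fun x => c * f x) x0 i = c * taylor_coef f x0 i.
Proof. by move=> sf; rewrite /taylor_coef (iterpdZ oU _ c sf) ?inE// mulrA. Qed.

Lemma taylor_coef_eq f g i : {in U, f =1 g} ->
  taylor_coef f x0 i = taylor_coef g x0 i.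
Proof. by move=> fg; rewrite /taylor_coef (iterpd_eq oU _ fg)// inE. Qed.

Lemma jet_eq_taylor_coef n f g i : jet_eq U x0 n f g -> (tr i < n)%N ->
  taylor_coef f x0 i = taylor_coef g x0 i.
Proof.
move=> [sf sg v] in_; apply/eqP; rewrite -subr_eq0 -taylor_coefN//.
rewrite -taylor_coefD//; last exact: smoothN.
by rewrite (taylor_coef_vanish v in_).
Qed.

Lemma jet_eq_tpoly n f : smooth U f ->
  jet_eq U x0 n.+1 f (tpoly n x0 (taylor_coef f x0)).
Proof.
move=> sf; have sp := smooth_tpoly oU n x0 (taylor_coef f x0).
split=> //; apply: vanish_taylor; first exact: smoothB.
move=> i; rewrite ltnS => in_; rewrite taylor_coefD//; last exact: smoothN.
by rewrite taylor_coefN// taylor_coef_tpoly in_ mul1r subrr.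
Qed.

End Taylor.

(** * The Hessian at the maximum of a solution of the eikonal equation *)

Section Eikonal.
Context {R : realType} {m : nat}.
Local Notation E := 'rV[R]_m.
Implicit Types (f g h : E -> R) (x y w : E).

Lemma near_diff_bound f x (e : R) : differentiable f x -> 0 < e ->
  \forall h \near (0 : E), `|f (x + h) - f x - 'd f x h| <= e * `|h|.
Proof.
move=> df e0; have [r r0 fr] := diff_bound df e0.
by apply/nbhs_normP; exists r => // h; rewrite /ball_/= sub0r normrN; exact: fr.
Qed.

Lemma near_norm_le x (e : R) : 0 < e -> \forall y \near x, `|y - x| <= e.
Proof.
move=> e0; apply/nbhs_normP; exists e => // y; rewrite /ball_/= distrC.
exact: ltW.
Qed.

Lemma near0_norm_le (e : R) : 0 < e -> \forall h \near (0 : E), `|h| <= e.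
Proof.
move=> e0; apply: filterS (near_norm_le 0 e0) => h; by rewrite subr0.
Qed.

(** The hypothesis in the two opposite directions of a coordinate axis bounds the
    derivative on both sides. For [c = 0] this is Fermat's rule at a minimum; in
    general it is satisfied at a minimum of [fun y => f y + c * `|y - x|]. *)
Lemma slope_bound f y (c : R) : differentiable f y -> 0 <= c ->
  (\forall h \near (0 : E), f y - c * `|h| <= f (y + h)) ->
  forall i, `|pd i f y| <= c.
Proof.
move=> df c0 fc i; apply/ler_addgt0Pr => e e0.
have [r r0 rP] : exists2 r : R, 0 < r & forall h : E, `|h| < r ->
    - ((c + e) * `|h|) <= 'd f y h.
  have [r r0 rP] := (nbhs_normP _ _).1 (filterI fc (near_diff_bound df e0)).
  exists r => // h hr; have := rP h; rewrite /ball_/= sub0r normrN.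
  move=> /(_ hr) []; move: ('d f y h) (f (y + h)) (f y) => D A B.
  by rewrite ler_norml => AB /andP[_ BA]; lra.
pose t := r / 2; have t0 : 0 < t by rewrite divr_gt0.
have tr : t < r by rewrite ltr_pdivrMr// mulr_natr mulr2n ltrDl.
have bound (u : R) : `|u| = t -> - ((c + e) * t) <= u * pd i f y.
  move=> ut; have ud : `|u *: delta_mx ord0 i : E| <= t.
    by rewrite normrZ ut ler_piMr// ?norm_delta_mx// ltW.
  have := rP _ (le_lt_trans ud tr).
  rewrite (diff_pd i u df); apply: le_trans; rewrite lerN2 ler_wpM2l//.
  by rewrite addr_ge0// ltW.
have b1 : - ((c + e) * t) <= t * pd i f y by rewrite bound// gtr0_norm.
have b2 : - ((c + e) * t) <= - t * pd i f y by rewrite bound// normrN gtr0_norm.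
rewrite -(ler_pM2r t0) -[X in _ * X](gtr0_norm t0) -normrM ler_norml.
by move: (pd i f y) b1 b2 => D b1 b2; apply/andP; split; lra.
Qed.

Lemma diff_sum_pd f x w : differentiable f x ->
  'd f x w = \sum_l w ord0 l * pd l f x.
Proof.
move=> df; rewrite {1}[w]row_sum_delta linear_sum; apply: eq_bigr => l _.
exact: diff_pd.
Qed.

Variables (U : set E) (oU : open U) (x0 : E) (Ux0 : U x0).

(** The other terms of the Leibniz formula contain an undifferentiated factor. *)
Lemma pd2M0 k l f g : smooth U f -> smooth U g -> f x0 = 0 -> g x0 = 0 ->
  pd l (pd k (fun x => f x * g x)) x0 =
  pd k f x0 * pd l g x0 + pd l f x0 * pd k g x0.
Proof.
move=> sf sg f0 g0; have Ux0' : x0 \in U by exact: mem_set.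
have dfg : {in U, pd k (fun x => f x * g x) =1
    fun x => pd k f x * g x + f x * pd k g x}.
  by move=> x /set_mem Ux; apply: pdM; exact: smooth_diff Ux.
have sdf := smooth_pd k sf; have sdg := smooth_pd k sg.
rewrite (pd_eq oU l dfg Ux0') pdD; last 2 first.
- by apply: smooth_diff Ux0; exact: smoothM.
- by apply: smooth_diff Ux0; exact: smoothM.
rewrite !pdM; try by apply: smooth_diff Ux0.
by rewrite f0 g0 mulr0 mul0r add0r addr0.
Qed.

Variables (v : E -> 'M[R]_m) (C : E -> R).
Hypotheses (sv : forall i j, smooth U (fun x => v x i j)) (sC : smooth U C).
Hypothesis vsym : forall i j, v x0 i j = v x0 j i.
Hypothesis eikonal : forall x, U x ->
  - 2 * C x = \sum_i \sum_j v x i j * pd i C x * pd j C x.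
Hypothesis max0 : forall x, U x -> x != x0 -> C x < C x0.

Lemma grad_max0 i : pd i C x0 = 0.
Proof.
apply/eqP; rewrite -normr_le0 -normrN.
have dC : differentiable C x0 by exact: smooth_diff sC _.
rewrite -pdN//; apply: slope_bound => //.
  exact: (@differentiableN _ _ _ C).
have [r r0 rU] := open_normP oU Ux0.
apply/nbhs_normP; exists r => // h; rewrite /ball_/= sub0r normrN => hr.
rewrite mul0r subr0 lerN2; have [->|h0] := eqVneq h 0; first by rewrite addr0.
by apply/ltW/max0; [exact: rU|rewrite -subr_eq0 addrAC subrr add0r].
Qed.

Lemma max_value0 : C x0 = 0.
Proof.
have := eikonal Ux0; rewrite big1 => [/eqP|i _].
  by rewrite mulf_eq0 oppr_eq0 pnatr_eq0/= => /eqP.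
by rewrite big1// => j _; rewrite !grad_max0 mulr0.
Qed.

Lemma max_le0 x : U x -> C x <= 0.
Proof.
move=> Ux; have [->|xx0] := eqVneq x x0; first by rewrite max_value0.
by rewrite -max_value0 ltW// max0.
Qed.

(** The eikonal equation bounds [C] by the square of its gradient, uniformly near
    [x0] because [v] is continuous. *)
Lemma eikonal_bound : exists2 M : R, 0 < M &
  \forall x \near x0, U x /\
    forall c : R, 0 <= c -> (forall i, `|pd i C x| <= c) -> - 2 * C x <= M * c ^+ 2.
Proof.
pose M := \sum_(i < m) \sum_(j < m) (`|v x0 i j| + 1).
have M0 : 0 <= M by apply: sumr_ge0 => i _; apply: sumr_ge0 => j _; rewrite addr_ge0.
exists (M + 1); first by rewrite ltr_wpDl.
near=> x; have Ux : U x by near: x; exact: open_nbhs_nbhs.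
split=> // c c0 cP; rewrite eikonal// (@le_trans _ _ (M * c ^+ 2))//; last first.
  by rewrite ler_wpM2r ?exprn_ge0// lerDl.
rewrite /M mulr_suml; apply: ler_sum => i _; rewrite mulr_suml; apply: ler_sum => j _.
apply: le_trans (ler_norm _) _; rewrite !normrM -mulrA expr2.
apply: ler_pM => //; last by apply: ler_pM.
have -> : v x i j = v x0 i j + (v x i j - v x0 i j) by rewrite addrC subrK.
apply: le_trans (ler_normD _ _) _; rewrite lerD2l distrC.
move: i j; near: x; apply: filter_forall => i; apply: filter_forall => j.
have /differentiable_continuous/cvgrPdist_le := smooth_diff (sv i j) Ux0.
by apply.
Unshelve. all: by end_near. Qed.

(** The function [d = sqrt (- 2 C)] satisfies [|grad d| = 1] for the metric
    away from [x0], so it decreases at a rate bounded below until it reaches its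
    unique zero. Were [d x < c |x - x0|], the minimizer of [d y + c |y - x|] over
    a small ball would be a point other than [x0] at which the slope of [d] is at
    most [c]. *)
Lemma quadratic_growth : exists2 c : R, 0 < c &
  \forall x \near x0, c * `|x - x0| ^+ 2 <= - 2 * C x.
Proof.
have [M M0 MP] := eikonal_bound.
pose c := (Num.sqrt (M + 1))^-1.
have c0 : 0 < c by rewrite invr_gt0 sqrtr_gt0 addr_gt0.
have Mc : M * c ^+ 2 < 1.
  rewrite exprVn sqr_sqrtr ?addr_ge0 ?ltW// ltr_pdivrMr ?addr_gt0//; lra.
have /nbhs_normP[r1 r10 r1P] := MP.
pose r := r1 / 2; have r0 : 0 < r by rewrite divr_gt0.
have rr1 : r < r1 by rewrite ltr_pdivrMr// mulr_natr mulr2n ltrDl.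
have BP x : `|x - x0| <= r -> U x /\
    forall c : R, 0 <= c -> (forall i, `|pd i C x| <= c) -> - 2 * C x <= M * c ^+ 2.
  by move=> xr; apply: r1P; rewrite /ball_/= distrC (le_lt_trans xr).
pose d x := Num.sqrt (- 2 * C x).
have dE x : U x -> d x ^+ 2 = - 2 * C x.
  by move=> Ux; rewrite sqr_sqrtr// mulr_le0// ?max_le0//; lra.
exists (c ^+ 2); first by rewrite exprn_gt0.
near=> x.
(* With this radius the minimizer found below is in the interior of the ball. *)
have xr : `|x - x0| <= r / 4.
  by near: x; apply: near_norm_le; rewrite divr_gt0.
have xr' : `|x - x0| <= r by lra.
have [Ux _] := BP _ xr'.
rewrite -dE// -exprMn ler_pXn2r ?nnegrE ?sqrtr_ge0//; last first.
  by rewrite mulr_ge0// ltW.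
rewrite leNgt; apply/negP => dx.
pose B := closed_ball_ Num.norm x0 r.
pose Phi y := d y + c * `|y - x|.
have BU y : B y -> U y.
  by rewrite /B/closed_ball_/= distrC => /BP[].
have cd y : U y -> {for y, continuous d}.
  move=> Uy; apply: (@continuous_comp _ _ _ (fun y => - 2 * C y) (@Num.sqrt R));
    last exact: sqrt_continuous.
  apply: (@continuousM _ _ (cst (- 2)) C); first exact: cst_continuous.
  exact/differentiable_continuous/(smooth_diff sC).
have cn y : {for y, continuous (fun y => c * `|y - x|)}.
  apply: (@continuousM _ _ (cst c) (fun y => `|y - x|)); first exact: cst_continuous.
  apply: (@continuous_comp _ _ _ (fun y => y - x) Num.norm);
    last exact: norm_continuous.
  by apply: (@continuousB _ _ _ id (cst x)); [exact: id|exact: cst_continuous].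
have cPhi : {within B, continuous Phi}.
  apply: continuous_in_subspaceT => y /set_mem/BU Uy.
  exact: (continuousD (cd y Uy) (cn y)).
have cB : compact B.
  apply: bounded_closed_compact; last exact: closed_closed_ball_.
  exists (`|x0| + r); split; first exact: num_real.
  move=> N rN y; rewrite /B/closed_ball_/= => yr.
  rewrite (le_trans _ (ltW rN))//.
  have -> : y = x0 - (x0 - y) by rewrite opprB addrC subrK.
  by rewrite (le_trans (ler_normB _ _))// lerD2l.
have B0 : B !=set0 by exists x0; rewrite /B/closed_ball_/= subrr normr0 ltW.
have [y /set_mem By ymin] := EVT_min_rV B0 cB cPhi.
have Phiyx : Phi y <= d x.
  have -> : d x = Phi x by rewrite /Phi subrr normr0 mulr0 addr0.
  by apply: ymin; rewrite inE /B/closed_ball_/= distrC.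
have dy0 : 0 <= d y by exact: sqrtr_ge0.
have yx : `|y - x| < r / 4.
  rewrite -(ltr_pM2l c0) (@le_lt_trans _ _ (d x))//.
    by apply: le_trans Phiyx; rewrite /Phi lerDr.
  by rewrite (lt_le_trans dx)// ler_pM2l.
have yx0 : `|y - x0| <= r / 2.
  rewrite (_ : y - x0 = (y - x) + (x - x0)); last by rewrite addrA subrK.
  by rewrite (le_trans (ler_normD _ _))//; lra.
have [|Uy slope] := BP y; first by lra.
have dy : d y = 0.
  apply/eqP; apply: contraT => dyN0.
  have dy1 : 0 < d y by rewrite lt_neqAle eq_sym dyN0.
  have : forall i, `|pd i C y| <= d y * c.
    move=> i; have dC := smooth_diff sC Uy.
    rewrite -normrN -pdN//; apply: slope_bound.
    - exact: (@differentiableN _ _ _ C).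
    - by rewrite mulr_ge0// ltW.
    near=> h.
    have hr : `|h| <= r / 2.
      by near: h; apply: near0_norm_le; rewrite divr_gt0.
    have hd : c * `|h| <= d y.
      rewrite mulrC -ler_pdivlMr//.
      by near: h; apply: near0_norm_le; rewrite divr_gt0.
    have Byh : B (y + h).
      rewrite /B/closed_ball_/= distrC addrAC.
      by rewrite (le_trans (ler_normD _ _))//; lra.
    have dyh : d y - c * `|h| <= d (y + h).
      have := ymin (y + h); rewrite inE => /(_ Byh); rewrite /Phi addrAC => min_y.
      have := ler_normD (y - x) h; rewrite -(ler_pM2l c0) mulrDr; lra.
    have : (d y - c * `|h|) ^+ 2 <= d (y + h) ^+ 2.
      by rewrite ler_pXn2r// ?nnegrE ?sqrtr_ge0// subr_ge0.
    rewrite (dE _ (BU _ Byh)) sqrrB dE// => ineq.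
    have : 0 <= (c * `|h|) ^+ 2 by rewrite exprn_ge0// mulr_ge0// ltW.
    move: ineq; rewrite mulr2n; move: (C (y + h)) (C y) (d y) => a b d'.
    by set ch := _ * `|h|; rewrite -[d' * c * _]mulrA -/ch; lra.
  move=> /(slope _ (mulr_ge0 dy0 (ltW c0))); rewrite -dE// exprMn mulrCA.
  by rewrite ler_pMr ?exprn_gt0// leNgt Mc.
have yE : y = x0.
  apply/eqP; apply: contraT => /(max0 Uy); rewrite max_value0 => Cy.
  by move: (dE _ Uy); rewrite dy expr0n/= => /esym/eqP; lra.
move: Phiyx; rewrite /Phi dy add0r yE distrC leNgt.
by rewrite dx.
Unshelve. all: by end_near. Qed.

Definition hessian : 'M[R]_m := \matrix_(k, l) pd k (pd l C) x0.

Lemma hessian_sym k l : hessian k l = hessian l k.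
Proof. by rewrite !mxE (pdC oU k l sC) ?inE. Qed.

(** A direction in the kernel of the Hessian would be one along which [C] is
    [o(t^2)], by the eikonal equation, against quadratic growth. *)
Lemma hessian_unit : hessian \in unitmx.
Proof.
rewrite -row_free_unit; apply: inj_row_free => w wH; apply/eqP.
apply: contraT => w0.
have [c c0 growth] := quadratic_growth; have [M M0 bound] := eikonal_bound.
(* Chosen so that M * e ^+ 2 < c. *)
pose e := Num.sqrt (c / (M + 1)).
have M1 : 0 < M + 1 by rewrite addr_gt0.
have e0 : 0 < e by rewrite sqrtr_gt0 divr_gt0.
have dpd i : differentiable (pd i C) x0 by exact: smooth_diff (smooth_pd i sC) _.
have nw : 0 < `|w| by rewrite normr_gt0.
have near_line (P : E -> Prop) : (\forall x \near x0, P x) ->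
    exists2 r : R, 0 < r & forall h : E, `|h| < r -> P (x0 + h).
  move=> /nbhs_normP[r r0 rP]; exists r => // h hr; apply: rP.
  by rewrite /ball_/= opprD addNKr normrN.
have [r r0 rP] := near_line _ (filterI growth bound).
have [r' r'0 r'P] : exists2 r : R, 0 < r & forall h : E, `|h| < r -> forall i,
    `|pd i C (x0 + h) - pd i C x0 - 'd (pd i C) x0 h| <= e * `|h|.
  have : \forall h \near (0 : E), forall i,
      `|pd i C (x0 + h) - pd i C x0 - 'd (pd i C) x0 h| <= e * `|h|.
    apply: (@filter_forall _ _ (fun i (h : E) =>
      `|pd i C (x0 + h) - pd i C x0 - 'd (pd i C) x0 h| <= e * `|h|) _
        (nbhs_filter (0 : E))) => i.
    exact: near_diff_bound.
  move=> /nbhs_normP[r' r'0 r'P]; exists r' => // h hr.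
  by apply: r'P; rewrite /ball_/= sub0r normrN.
pose t := Num.min r r' / 2 / `|w|.
have rr' : 0 < Num.min r r' by rewrite lt_min r0.
have t0 : 0 < t by rewrite !divr_gt0.
have : `|t *: w| < Num.min r r'.
  rewrite normrZ gtr0_norm// divfK ?gt_eqF//.
  by rewrite ltr_pdivrMr// mulr_natr mulr2n ltrDl.
rewrite lt_min => /andP[/rP[grow [_ bd]] /r'P dbd].
have {}dbd i : `|pd i C (x0 + t *: w)| <= e * `|t *: w|.
  have := dbd i; rewrite grad_max0 subr0 linearZ/= diff_sum_pd//.
  have -> : \sum_l w ord0 l * pd l (pd i C) x0 = (w *m hessian) ord0 i.
    by rewrite mxE; apply: eq_bigr => l _; rewrite mxE.
  by rewrite wH mxE scaler0 subr0.
have := bd _ (mulr_ge0 (ltW e0) (normr_ge0 _)) dbd.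
rewrite exprMn mulrA => up.
have nt : 0 < `|t *: w| by rewrite normrZ mulr_gt0// gtr0_norm.
have cM : c <= M * (c / (M + 1)).
  have tw2 : 0 < `|t *: w| ^+ 2 by rewrite exprn_gt0.
  have e2 : e ^+ 2 = c / (M + 1) by rewrite sqr_sqrtr// divr_ge0// ltW.
  by have := le_trans grow up; rewrite addrAC subrr add0r ler_pM2r// e2.
suff : M * (c / (M + 1)) < c by rewrite ltNge cM.
by rewrite mulrCA gtr_pMr// ltr_pdivrMr// mul1r ltrDl.
Qed.

(** Two differentiations of the eikonal equation at the maximum: the gradient
    vanishes there, so only products of two second derivatives survive. *)
Lemma hessian_eikonal : hessian + hessian *m v x0 *m hessian = 0.
Proof.
have Ux0' : x0 \in U by exact: mem_set.
have sd i : smooth U (pd i C) := smooth_pd i sC.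
pose F x := \sum_i \sum_j (v x i j * pd i C x) * pd j C x.
have FE : {in U, (fun x => - 2 * C x) =1 F}.
  by move=> x /set_mem Ux; rewrite eikonal.
apply/matrixP => l k; rewrite [RHS]mxE.
have : iterpd [:: l; k] (fun x => - 2 * C x) x0 = iterpd [:: l; k] F x0.
  exact: (iterpd_eq oU [:: l; k] FE Ux0').
have -> : iterpd [:: l; k] (fun x => - 2 * C x) x0 = - 2 * pd l (pd k C) x0.
  have pZ i f x : differentiable f x -> pd i (fun y => - 2 * f y) x = - 2 * pd i f x.
    by move=> df; rewrite pdM// pd_cst mul0r add0r.
  rewrite /= -pZ; last by apply: smooth_diff (sd k) _.
  apply: (pd_eq oU l _ Ux0') => x /set_mem Ux.
  by apply: pZ; exact: smooth_diff Ux.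
have smF i j : smooth U (fun x => v x i j * pd i C x) by exact: smoothM.
have -> : iterpd [:: l; k] F x0 = \sum_i \sum_j
    iterpd [:: l; k] (fun x => (v x i j * pd i C x) * pd j C x) x0.
  rewrite (iterpd_sum oU) // => [|i]; last first.
    by apply: smooth_sum => // j _; exact: smoothM.
  apply: eq_bigr => i _; rewrite (iterpd_sum oU)// => j; exact: smoothM.
have term i j : iterpd [:: l; k] (fun x => (v x i j * pd i C x) * pd j C x) x0 =
    v x0 i j * hessian k i * hessian l j + v x0 i j * hessian l i * hessian k j.
  rewrite /= pd2M0//; last 2 first.
  - by rewrite grad_max0 mulr0.
  - exact: grad_max0.
  have pdvC p : pd p (fun x => v x i j * pd i C x) x0 = v x0 i j * hessian p i.
    rewrite pdM; [|exact: smooth_diff (sv i j) _|exact: smooth_diff (sd i) _].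
    by rewrite grad_max0 mulr0 add0r mxE.
  by rewrite !pdvC !mxE.
under eq_bigr => i _ do under eq_bigr => j _ do rewrite term.
under eq_bigr do rewrite big_split/=.
rewrite big_split/=.
have HvH p q : \sum_i \sum_j v x0 i j * hessian p i * hessian q j =
    (hessian *m v x0 *m hessian) p q.
  rewrite [RHS]mxE exchange_big/=; apply: eq_bigr => j _.
  rewrite [(_ *m v x0) p j]mxE mulr_suml; apply: eq_bigr => i _.
  by rewrite [hessian j q]hessian_sym; ring.
rewrite !HvH.
have -> : (hessian *m v x0 *m hessian) k l = (hessian *m v x0 *m hessian) l k.
  rewrite -!HvH exchange_big/=; apply: eq_bigr => j _; apply: eq_bigr => i _.
  by rewrite vsym; ring.
move=> e2; rewrite [LHS]mxE [hessian l k]mxE.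
by move: ((hessian *m v x0 *m hessian) l k) (pd l (pd k C) x0) e2 => a b e2; lra.
Qed.

(** An invertible [H] with [H + H v H = 0] can only be minus the inverse of [v]. *)
Lemma hessianE : hessian = - invmx (v x0).
Proof.
have H0 : hessian *m (1%:M + v x0 *m hessian) = 0.
  by rewrite mulmxDr mulmx1 mulmxA hessian_eikonal.
have vH : v x0 *m hessian = - 1%:M.
  apply/eqP; rewrite -addr_eq0 addrC; apply/eqP.
  by rewrite -[LHS](mulKmx hessian_unit) H0 mulmx0.
have vH1 : v x0 *m - hessian = 1%:M by rewrite mulmxN vH opprK.
have [vu _] := mulmx1_unit vH1.
by have := mulKmx vu (- hessian); rewrite vH1 mulmx1 => ->; rewrite opprK.
Qed.

End Eikonal.

(** * The orders of the Kolmogorov equation in the time step *)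

Section Equations.
Context {R : realType} {m : nat}.
Local Notation E := 'rV[R]_m.
Variables (mu : E -> E) (v : E -> 'M[R]_m) (C : int -> E -> R).

Lemma fX_m2F : fX mu v C (-1 - 1) = fun x =>
  - 2 * C (-1) x - \sum_i \sum_j v x i j * pd i (C (-1)) x * pd j (C (-1)) x.
Proof. by []. Qed.

Lemma fX_m1F : fX mu v C (0 - 1) = fun x =>
  - (\sum_i \sum_j v x i j * pd i (C (-1)) x * pd j (C 0) x) - GX mu v C 0 x.
Proof. by []. Qed.

Lemma fX_succF (k : nat) : fX mu v C (k.+1%:Z - 1) = fun x => C k.+1%:Z x
  - k.+1%:R^-1 * (\sum_i \sum_j v x i j * pd i (C (-1)) x * pd j (C k.+1%:Z) x)
  - GX mu v C k.+1 x.
Proof.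
apply/funext => x; rewrite /fX; have -> : (k.+1%:Z - 1 == -2) = false by lia.
have -> : (k.+1%:Z - 1 == -1) = false by lia.
by have -> : `|(k.+1%:Z - 1 + 1)%R|%N = k.+1 by lia.
Qed.

End Equations.

Section KolmogorovExpansion.
Context {R : realType} {m : nat}.
Local Notation E := 'rV[R]_m.
Implicit Types (f g : E -> R) (x : E).

(** A polynomial has finitely many roots. *)
Lemma poly_eq_pos (p q : {poly R}) :
  (forall d : R, 0 < d -> p.[d] = q.[d]) -> p = q.
Proof.
move=> pq; apply/eqP; rewrite -subr_eq0; apply/eqP.
pose rs : seq R := [seq k.+1%:R | k <- iota 0 (size (p - q))].
apply: (@roots_geq_poly_eq0 _ _ rs); last by rewrite size_map size_iota.
- apply/allP => _ /mapP[k _ ->].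
  by rewrite rootE !hornerE pq ?subrr// ltr0n.
- rewrite map_inj_uniq ?iota_uniq// => i j /eqP.
  by rewrite eqr_nat => /eqP [].
Qed.

Variables (U : set E) (oU : open U).

Lemma pdZr i f (c : R) x : differentiable f x ->
  pd i (fun y => f y * c) x = pd i f x * c.
Proof. by move=> df; rewrite pdM// pd_cst mulr0 addr0. Qed.

Lemma iterpd_sumZr s n (F : 'I_n -> E -> R) (c : 'I_n -> R) :
  (forall k, smooth U (F k)) ->
  {in U, iterpd s (fun x => \sum_k F k x * c k) =1
         fun x => \sum_k iterpd s (F k) x * c k}.
Proof.
move=> sF x Ux; rewrite (iterpd_sum oU)//; last first.
  by move=> k; apply: smoothM => //; exact: smooth_cst.
apply: eq_bigr => k _; elim: s x Ux => [//|i s IHs] x Ux /=.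
rewrite (pd_eq oU i IHs Ux) pdZr//; apply: sF; exact: set_mem.
Qed.

Variables (mu : E -> E) (v : E -> 'M[R]_m).
Hypothesis sv : forall i j, smooth U (fun x => v x i j).
Hypothesis vsym : forall x i j, v x i j = v x j i.
Hypothesis detv_gt0 : forall x, U x -> 0 < \det (v x).

Lemma smooth_Dv : smooth U (Dv v).
Proof.
apply: smoothM (smooth_cst oU _) _ => //; apply: smooth_ln => //.
apply: smooth_sum => // s _; apply: smoothM => //; first exact: smooth_cst.
exact: smooth_prod.
Qed.

Variables (K : nat) (C : int -> E -> R).
Hypothesis sC : forall k : int, -1 <= k <= K%:Z -> smooth U (C k).

Lemma smoothCm1 : smooth U (C (-1)). Proof. by apply: sC; lia. Qed.

Lemma smoothCn n : (n <= K)%N -> smooth U (C n%:Z).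
Proof. by move=> nK; apply: sC; lia. Qed.

(** The coefficient of [Delta ^ (h - 1)] in the part of the expansion that
    depends on [x]. *)
Definition log_coef (h : nat) : E -> R :=
  match h with
  | 0 => C (-1)
  | 1 => fun x => C 0 x - Dv v x
  | k.+1 => fun x => C k%:Z x * (k`!%:R)^-1
  end.

Lemma smooth_log_coef h : (h <= K.+1)%N -> smooth U (log_coef h).
Proof.
case: h => [_|[_|k kK]]; first exact: smoothCm1.
  by apply: smoothB; [|exact: (@smoothCn 0)|exact: smooth_Dv].
by apply: smoothM (smooth_cst oU _) => //; exact: smoothCn.
Qed.

Lemma log_expansionE Delta x : Delta != 0 -> log_expansion v K C Delta x =
  - (m%:R / 2) * ln (2 * pi * Delta)
  + \sum_(h < K.+2) log_coef h x * (Delta ^+ h / Delta).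
Proof.
move=> D0; rewrite /log_expansion !big_ord_recl /= expr0 expr1.
set S1 := \sum_(i < K) _; set S2 := \sum_(i < K) _.
have -> : S1 = S2.
  apply: eq_bigr => k _; rewrite /bump/= !add1n/= [Delta ^+ k.+2]exprS.
  by field; rewrite D0 pnatr_eq0 -lt0n fact_gt0.
have -> : C (Posz 0) x * (1 / (0`!)%:R) = C 0 x :> R by rewrite fact0 divr1 mulr1.
by field.
Qed.

Lemma pd_log_expansion i Delta : Delta != 0 ->
  {in U, pd i (log_expansion v K C Delta) =1
    fun x => \sum_(h < K.+2) pd i (log_coef h) x * (Delta ^+ h / Delta)}.
Proof.
move=> D0 x Ux; have Ux' := set_mem Ux.
have -> : log_expansion v K C Delta = (fun x =>
    - (m%:R / 2) * ln (2 * pi * Delta)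
    + \sum_(h < K.+2) log_coef h x * (Delta ^+ h / Delta)).
  by apply/funext => y; exact: log_expansionE.
rewrite pdD; last 2 first.
- exact: differentiable_cst.
- apply: smooth_diff Ux'; apply: smooth_sum => // h _.
  by apply: smoothM (smooth_cst oU _) => //; apply: smooth_log_coef; rewrite -ltnS.
rewrite pd_cst add0r; apply: (iterpd_sumZr [:: i] _ _ Ux) => h.
by apply: smooth_log_coef; rewrite -ltnS.
Qed.

Lemma pd2_log_expansion i j Delta : Delta != 0 ->
  {in U, pd i (pd j (log_expansion v K C Delta)) =1
    fun x => \sum_(h < K.+2) pd i (pd j (log_coef h)) x * (Delta ^+ h / Delta)}.
Proof.
move=> D0 x Ux; rewrite (pd_eq oU i (pd_log_expansion j D0) Ux).
apply: (iterpd_sumZr [:: i] _ _ Ux) => h.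
by apply/smooth_pd/smooth_log_coef; rewrite -ltnS.
Qed.

Lemma derive1_log_expansion Delta x : 0 < Delta ->
  derive1 (fun d => log_expansion v K C d x) Delta =
  - (m%:R / 2) / Delta
  + \sum_(h < K.+2) log_coef h x * ((h%:R - 1) * (Delta ^+ h / Delta ^+ 2)).
Proof.
move=> D0; have D00 : Delta != 0 by exact: lt0r_neq0.
pose c1 : R := - (m%:R / 2).
pose F (h : 'I_K.+2) : R -> R :=
  log_coef h x *: ((fun d : R => d ^+ h) * (fun d => d^-1)).
pose G : R -> R := c1 *: (cst (ln (2 * pi)) + @ln R).
have -> : derive1 (fun d => log_expansion v K C d x) Delta =
    'D_1 (G + \sum_(h < K.+2) F h) Delta.
  rewrite derive1E; apply: near_eq_derive; near=> d.
  have d0 : 0 < d by near: d; exact: lt_nbhsr.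
  rewrite log_expansionE ?lt0r_neq0// lnM ?posrE ?mulr_gt0 ?pi_gt0//.
  by rewrite fctE fct_sumE /G /F.
have dG : is_derive Delta 1 G (c1 / Delta).
  have dln := is_derive1_ln D0.
  by apply: is_derive_eq; rewrite add0r.
have dF (h : 'I_K.+2) : is_derive Delta 1 (F h)
    (log_coef h x * ((h%:R - 1) * (Delta ^+ h / Delta ^+ 2))).
  have dV : is_derive Delta 1 (fun d : R => d^-1) (- Delta ^- 2).
    apply: DeriveDef; first exact: (@derivableV _ _ id).
    by rewrite (@deriveV _ _ id)// derive_id [_ *: _]mulr1.
  have dX : is_derive Delta 1 (fun d : R => d ^+ h) (h%:R * Delta ^+ h.-1).
    apply: DeriveDef; first exact: exprn_derivable.
    by rewrite exp_derive [_ *: _]mulr1.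
  apply: is_derive_eq; rewrite -![_ *: _]/(_ * _); congr (_ * _).
  case: (nat_of_ord h) => [|n] /=.
    by rewrite expr0; field.
  by rewrite exprS; field.
by rewrite derive_val.
Unshelve. all: by end_near. Qed.

Section Coefficients.
Variables (x : E) (Ux : U x).

Let Ux' : x \in U. Proof. exact: mem_set. Qed.

Definition quad (p q : 'I_m -> R) : R := \sum_i \sum_j v x i j * p i * q j.

Definition grad f : 'I_m -> R := fun i => pd i f x.

(** The opposite of the part of the right-hand side that is linear in the
    log-density. *)
Definition drift_op f : R :=
  \sum_i mu x ord0 i * pd i f x
  - \sum_i \sum_j pd i (fun y => v y i j) x * pd j f x
  - 2^-1 * \sum_i \sum_j v x i j * pd i (pd j f) x.

Definition source : R :=
  - (\sum_i pd i (fun y => mu y ord0 i) x)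
  + 2^-1 * (\sum_i \sum_j pd i (pd j (fun y => v y i j)) x).

Lemma quadC p q : quad p q = quad q p.
Proof.
rewrite /quad exchange_big/=; apply: eq_bigr => i _; apply: eq_bigr => j _.
by rewrite vsym; ring.
Qed.

Lemma quadDl p p' q : quad (fun i => p i + p' i) q = quad p q + quad p' q.
Proof.
rewrite /quad -big_split; apply: eq_bigr => i _; rewrite -big_split.
by apply: eq_bigr => j _ /=; ring.
Qed.

Lemma quadZl c p q : quad (fun i => p i * c) q = c * quad p q.
Proof.
rewrite /quad mulr_sumr; apply: eq_bigr => i _; rewrite mulr_sumr.
by apply: eq_bigr => j _; ring.
Qed.

Lemma quadDr p q q' : quad p (fun i => q i + q' i) = quad p q + quad p q'.
Proof. by rewrite quadC quadDl !(quadC p). Qed.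

Lemma quadZr c p q : quad p (fun i => q i * c) = c * quad p q.
Proof. by rewrite quadC quadZl (quadC p). Qed.

Lemma quadBr p q q' : quad p (fun i => q i - q' i) = quad p q - quad p q'.
Proof.
rewrite quadDr; congr (_ + _); rewrite -[RHS]mulN1r -quadZr.
by congr quad; apply/funext => i; rewrite mulrN1.
Qed.

Lemma quadBl p p' q : quad (fun i => p i - p' i) q = quad p q - quad p' q.
Proof. by rewrite quadC quadBr !(quadC q). Qed.

Lemma quad_sumr n p (q : 'I_n -> 'I_m -> R) :
  quad p (fun i => \sum_k q k i) = \sum_k quad p (q k).
Proof.
elim: n q => [|n IHn] q.
  rewrite big_ord0 /quad big1// => i _; rewrite big1// => j _.
  by rewrite big_ord0 mulr0.
rewrite big_ord_recl -IHn -quadDr; congr quad; apply/funext => i.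
by rewrite big_ord_recl.
Qed.

Lemma quad_suml n (p : 'I_n -> 'I_m -> R) q :
  quad (fun i => \sum_k p k i) q = \sum_k quad (p k) q.
Proof. by rewrite quadC quad_sumr; apply: eq_bigr => k _; rewrite quadC. Qed.

Definition log_grad h : 'I_m -> R := grad (log_coef h).

Lemma kolmogorov_rhsE Delta : Delta != 0 ->
  kolmogorov_rhs mu v (log_expansion v K C Delta) x =
  source - \sum_(h < K.+2) drift_op (log_coef h) * (Delta ^+ h / Delta)
  + 2^-1 * \sum_(a < K.+2) \sum_(b < K.+2) quad (log_grad a) (log_grad b) *
      (Delta ^+ a / Delta * (Delta ^+ b / Delta)).
Proof.
move=> D0; rewrite /kolmogorov_rhs -/source.
pose c (h : 'I_K.+2) := Delta ^+ h / Delta.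
have pdl i : pd i (log_expansion v K C Delta) x = \sum_(h < K.+2) log_grad h i * c h.
  exact: pd_log_expansion.
have pd2l i j : pd i (pd j (log_expansion v K C Delta)) x =
    \sum_(h < K.+2) pd i (pd j (log_coef h)) x * c h.
  exact: pd2_log_expansion.
have -> : \sum_i mu x ord0 i * pd i (log_expansion v K C Delta) x =
    \sum_(h < K.+2) (\sum_i mu x ord0 i * pd i (log_coef h) x) * c h.
  under eq_bigr do rewrite pdl mulr_sumr.
  rewrite exchange_big/=; apply: eq_bigr => h _; rewrite mulr_suml.
  by apply: eq_bigr => i _; rewrite mulrA.
have -> : \sum_i \sum_j pd i (fun y => v y i j) x *
      pd j (log_expansion v K C Delta) x =
    \sum_(h < K.+2) (\sum_i \sum_j pd i (fun y => v y i j) x * pd j (log_coef h) x) * c h.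
  under eq_bigr do under eq_bigr do rewrite pdl mulr_sumr.
  under eq_bigr do rewrite exchange_big/=.
  rewrite exchange_big/=; apply: eq_bigr => h _; rewrite mulr_suml.
  apply: eq_bigr => i _; rewrite mulr_suml.
  by apply: eq_bigr => j _; rewrite mulrA.
have -> : \sum_i \sum_j v x i j * pd i (pd j (log_expansion v K C Delta)) x =
    \sum_(h < K.+2) (\sum_i \sum_j v x i j * pd i (pd j (log_coef h)) x) * c h.
  transitivity (\sum_i \sum_j \sum_(h < K.+2)
      v x i j * (pd i (pd j (log_coef h)) x * c h)).
    apply: eq_bigr => i _; apply: eq_bigr => j _.
    by rewrite -mulr_sumr; congr (_ * _); exact: pd2l.
  under eq_bigr do rewrite exchange_big/=.
  rewrite exchange_big/=; apply: eq_bigr => h _; rewrite mulr_suml.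
  apply: eq_bigr => i _; rewrite mulr_suml.
  by apply: eq_bigr => j _; rewrite mulrA.
have -> : \sum_i \sum_j pd i (log_expansion v K C Delta) x * v x i j *
      pd j (log_expansion v K C Delta) x =
    \sum_(a < K.+2) \sum_(b < K.+2) quad (log_grad a) (log_grad b) * (c a * c b).
  transitivity (quad (fun i => \sum_(h < K.+2) log_grad h i * c h)
                     (fun i => \sum_(h < K.+2) log_grad h i * c h)).
    apply: eq_bigr => i _; apply: eq_bigr => j _.
    by rewrite !pdl; congr (_ * _); exact: mulrC.
  rewrite quad_suml; apply: eq_bigr => a _; rewrite quad_sumr.
  by apply: eq_bigr => b _; rewrite quadZl quadZr; ring.
rewrite -/c; have -> : \sum_(h < K.+2) drift_op (log_coef h) * c h =
    \sum_(h < K.+2) (\sum_i mu x ord0 i * pd i (log_coef h) x) * c h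
    - \sum_(h < K.+2) (\sum_i \sum_j pd i (fun y => v y i j) x * pd j (log_coef h) x) * c h
    - 2^-1 * \sum_(h < K.+2) (\sum_i \sum_j v x i j * pd i (pd j (log_coef h)) x) * c h.
  rewrite mulr_sumr -!sumrB; apply: eq_bigr => h _; rewrite /drift_op; ring.
ring.
Qed.

(** [Delta ^ 2] times the difference of the two sides of the equation. *)
Definition diff_poly : {poly R} :=
  \poly_(h < K.+2) ((h%:R - 1) * log_coef h x)
  - (m%:R / 2)%:P * 'X - source%:P * 'X^2
  + (\poly_(h < K.+2) drift_op (log_coef h)) * 'X
  - (2^-1)%:P * \sum_(a < K.+2) \sum_(b < K.+2)
      (quad (log_grad a) (log_grad b))%:P * ('X^a * 'X^b).

Lemma kolmogorov_diffE Delta : 0 < Delta ->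
  Delta ^+ 2 * kolmogorov_diff mu v (log_expansion v K C) Delta x =
  diff_poly.[Delta].
Proof.
move=> D_gt0; have D0 : Delta != 0 by exact: lt0r_neq0.
rewrite /kolmogorov_diff derive1_log_expansion// kolmogorov_rhsE// /diff_poly.
rewrite !(hornerD, hornerN, hornerM, hornerC, hornerX, hornerXn, horner_poly).
have -> : \sum_(h < K.+2) log_coef h x * ((h%:R - 1) * (Delta ^+ h / Delta ^+ 2)) =
    (\sum_(h < K.+2) (h%:R - 1) * log_coef h x * Delta ^+ h) / Delta ^+ 2.
  by rewrite mulr_suml; apply: eq_bigr => h _; field.
have -> : \sum_(h < K.+2) drift_op (log_coef h) * (Delta ^+ h / Delta) =
    (\sum_(h < K.+2) drift_op (log_coef h) * Delta ^+ h) / Delta.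
  by rewrite mulr_suml; apply: eq_bigr => h _; field.
have -> : \sum_(a < K.+2) \sum_(b < K.+2) quad (log_grad a) (log_grad b) *
      (Delta ^+ a / Delta * (Delta ^+ b / Delta)) =
    (\sum_(a < K.+2) \sum_(b < K.+2)
      (quad (log_grad a) (log_grad b))%:P * ('X^a * 'X^b)).[Delta] / Delta ^+ 2.
  rewrite horner_sum mulr_suml; apply: eq_bigr => a _.
  rewrite horner_sum mulr_suml; apply: eq_bigr => b _; by rewrite !(hornerM, hornerC, hornerXn); field.
by field.
Qed.

Lemma coef_diff_poly n : (n < K.+2)%N -> diff_poly`_n =
  (n%:R - 1) * log_coef n x - (n == 1%N)%:R * (m%:R / 2) - (n == 2)%:R * source
  + (0 < n)%:R * drift_op (log_coef n.-1)
  - 2^-1 * \sum_(a < n.+1) quad (log_grad a) (log_grad (n - a)%N).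
Proof.
move=> nK; rewrite /diff_poly !(coefD, coefN) coefMX !coefCM coefX coefXn.
rewrite !coef_poly nK; congr (_ - _ - _ + _ - _).
- by rewrite mulrC.
- by rewrite mulrC.
- by case: n nK => [|n] nK /=; [rewrite mul0r|rewrite mul1r ltnW].
congr (_ * _); rewrite coef_sum.
transitivity (\sum_(a < K.+2 | (a < n.+1)%N)
  quad (log_grad a) (log_grad (n - a)%N)); last first.
  by rewrite (big_ord_narrow nK).
rewrite [RHS]big_mkcond; apply: eq_bigr => a _; rewrite coef_sum.
case: ifPn => an; last first.
  rewrite big1// => b _; rewrite coefCM -exprD coefXn.
  rewrite [_ == _](_ : _ = false) ?mulr0//; lia.
have nalt : (n - a < K.+2)%N by lia.
rewrite (bigD1 (Ordinal nalt))//= coefCM -exprD coefXn subnKC// eqxx mulr1.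
rewrite big1 ?addr0// => b bna; rewrite coefCM -exprD coefXn.
rewrite [_ == _](_ : _ = false) ?mulr0//; apply/negbTE; apply: contraNneq bna => nab.
by apply/eqP/val_inj; rewrite /= nab addKn.
Qed.

(** The lowest order is [-2], hence the shift by two of the indices. *)
Lemma diff_poly0 : laurent_terms_vanish (-2) (K%:Z - 1)
    (fun Delta => kolmogorov_diff mu v (log_expansion v K C) Delta x) ->
  forall n, (n < K.+2)%N -> diff_poly`_n = 0.
Proof.
move=> [a [N [aE a0]]] n nK.
have -> : diff_poly = \poly_(h < N) a (-2 + h%:Z).
  apply: poly_eq_pos => d d0; rewrite -kolmogorov_diffE// aE// horner_poly.
  rewrite mulr_sumr; apply: eq_bigr => h _; rewrite mulrCA; congr (_ * _).
  by rewrite exprzDr ?unitfE ?lt0r_neq0// mulrA -exprnN mulfV ?mul1r// expf_neq0// lt0r_neq0.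
by rewrite coef_poly; case: ifP => // _; apply: a0; lia.
Qed.

Lemma pdB i f g : smooth U f -> smooth U g ->
  {in U, pd i (fun y => f y - g y) =1 fun y => pd i f y - pd i g y}.
Proof.
move=> sf sg y /set_mem Uy; rewrite pdD ?pdN//; try exact: smooth_diff Uy.
by apply: smooth_diff Uy; exact: smoothN.
Qed.

Lemma log_grad1 : log_grad 1 = fun i => grad (C 0) i - grad (Dv v) i.
Proof.
by apply/funext => i; apply: pdB Ux'; [exact: (@smoothCn 0)|exact: smooth_Dv].
Qed.

Lemma log_gradSS k : (k.+1 <= K)%N ->
  log_grad k.+2 = fun i => grad (C k.+1%:Z) i * ((k.+1)`!%:R)^-1.
Proof.
by move=> kK; apply/funext => i; apply: pdZr; exact: smooth_diff (smoothCn kK) _.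
Qed.

Lemma drift_opZ f c : smooth U f -> drift_op (fun y => f y * c) = c * drift_op f.
Proof.
move=> sf; have pdc i : {in U, pd i (fun y => f y * c) =1 fun y => pd i f y * c}.
  by move=> y /set_mem Uy; apply: pdZr; exact: smooth_diff Uy.
have pd2c i j : pd i (pd j (fun y => f y * c)) x = pd i (pd j f) x * c.
  rewrite (pd_eq oU i (pdc j) Ux') pdZr//.
  exact: smooth_diff (smooth_pd j sf) _.
have e1 : \sum_i mu x ord0 i * pd i (fun y => f y * c) x =
    c * \sum_i mu x ord0 i * pd i f x.
  by rewrite mulr_sumr; apply: eq_bigr => i _; rewrite pdc//; ring.
have e2 : \sum_i \sum_j pd i (fun y => v y i j) x * pd j (fun y => f y * c) x =
    c * \sum_i \sum_j pd i (fun y => v y i j) x * pd j f x.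
  rewrite mulr_sumr; apply: eq_bigr => i _; rewrite mulr_sumr.
  by apply: eq_bigr => j _; rewrite pdc//; ring.
have e3 : \sum_i \sum_j v x i j * pd i (pd j (fun y => f y * c)) x =
    c * \sum_i \sum_j v x i j * pd i (pd j f) x.
  rewrite mulr_sumr; apply: eq_bigr => i _; rewrite mulr_sumr.
  by apply: eq_bigr => j _; rewrite pd2c; ring.
rewrite /drift_op !mulrBr [in RHS]mulrCA.
by congr (_ - _ - _ * _); [exact: e1|exact: e2|exact: e3].
Qed.

Lemma fX_m2E : fX mu v C (-2) x = 2 * diff_poly`_0.
Proof.
rewrite coef_diff_poly// big_ord_recl big_ord0 subn0 /fX /=.
by rewrite -[\sum_i _]/(quad (grad (C (-1))) (grad (C (-1)))) /log_grad/=; field.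
Qed.

Lemma fX_m1E : fX mu v C (-1) x = diff_poly`_1.
Proof.
rewrite coef_diff_poly// !big_ord_recl big_ord0 subn0 /bump/= subnn.
rewrite [X in X + (_ + _)]quadC -[quad _ (log_grad 0)]/(quad _ _) /fX /=.
rewrite log_grad1 quadBl.
rewrite -[\sum_i \sum_j v x i j * pd i (C (-1)) x * pd j (C 0) x]/(quad (log_grad 0) (grad (C 0))).
rewrite /GX0 -[\sum_i \sum_j v x i j * pd i (C (-1)) x * pd j (Dv v) x]/(quad (log_grad 0) (grad (Dv v))).
rewrite [quad (grad (C 0)) _]quadC [quad (grad (Dv v)) _]quadC /drift_op/=.
by field.
Qed.

Lemma GX1E : GX1 mu v C x = source - drift_op (log_coef 1)
  + 2^-1 * quad (log_grad 1) (log_grad 1).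
Proof.
have sC0 : smooth U (C 0) by exact: (@smoothCn 0).
have p1 i : pd i (log_coef 1) x = pd i (C 0) x - pd i (Dv v) x.
  by apply: pdB Ux' => //; exact: smooth_Dv.
have p2 i j : pd i (pd j (log_coef 1)) x =
    pd i (pd j (C 0)) x - pd i (pd j (Dv v)) x.
  rewrite (pd_eq oU i (pdB j sC0 smooth_Dv) Ux').
  by apply: pdB Ux'; apply: smooth_pd => //; exact: smooth_Dv.
pose A := \sum_i mu x ord0 i * (pd i (C 0) x - pd i (Dv v) x).
pose B := \sum_i \sum_j pd i (fun y => v y i j) x * (pd j (C 0) x - pd j (Dv v) x).
pose D2 := \sum_i \sum_j
  v x i j * (pd i (pd j (C 0)) x - pd i (pd j (Dv v)) x).
have -> : drift_op (log_coef 1) = A - B - 2^-1 * D2.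
  congr (_ - _ - _ * _).
  - by apply: eq_bigr => i _; rewrite p1.
  - by apply: eq_bigr => i _; apply: eq_bigr => j _; rewrite p1.
  - by apply: eq_bigr => i _; apply: eq_bigr => j _; rewrite p2.
have -> : GX1 mu v C x = source - A + B + 2^-1 * (D2 + quad (log_grad 1) (log_grad 1)).
  rewrite /GX1 /source; congr (_ - _ + _ + _ * _).
  rewrite /D2 /quad -big_split; apply: eq_bigr => i _.
  rewrite -big_split; apply: eq_bigr => j _ /=.
  by rewrite log_grad1 /grad -mulrA -mulrDr.
by move: A B D2 => A B D2; ring.
Qed.

Lemma GX2E k : GX2 mu v C k x = - drift_op (C k.-1%:Z)
  + 2^-1 * (quad (grad (C 0)) (grad (C k.-1%:Z))
            - 2 * quad (grad (Dv v)) (grad (C k.-1%:Z))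
            + \sum_(h < k.-1) 'C(k.-1, h)%:R *
                quad (grad (C h%:Z)) (grad (C (k.-1 - h)%N%:Z))).
Proof.
rewrite /GX2.
have -> : \sum_i \sum_j v x i j *
    ((pd i (C 0) x - 2 * pd i (Dv v) x) * pd j (C k.-1%:Z) x +
      \sum_(0 <= h < k.-1)
       'C(k.-1, h)%:R * pd i (C h%:Z) x * pd j (C (k.-1 - h)%N%:Z) x) =
    quad (grad (C 0)) (grad (C k.-1%:Z))
    - 2 * quad (grad (Dv v)) (grad (C k.-1%:Z))
    + \sum_(h < k.-1) 'C(k.-1, h)%:R *
        quad (grad (C h%:Z)) (grad (C (k.-1 - h)%N%:Z)).
  have -> : \sum_(h < k.-1) 'C(k.-1, h)%:R *
        quad (grad (C h%:Z)) (grad (C (k.-1 - h)%N%:Z)) =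
      \sum_i \sum_j v x i j * \sum_(0 <= h < k.-1)
       'C(k.-1, h)%:R * pd i (C h%:Z) x * pd j (C (k.-1 - h)%N%:Z) x.
    under eq_bigr do rewrite /quad mulr_sumr.
    rewrite exchange_big/=; apply: eq_bigr => i _.
    under eq_bigr do rewrite mulr_sumr.
    rewrite exchange_big/=; apply: eq_bigr => j _.
    rewrite big_mkord mulr_sumr; apply: eq_bigr => h _.
    by rewrite /grad; ring.
  rewrite -quadZl -quadBl /quad -big_split; apply: eq_bigr => i _.
  rewrite -big_split; apply: eq_bigr => j _ /=.
  by rewrite /grad; ring.
rewrite /drift_op; ring.
Qed.

(** At order [Delta ^ k] the square of the gradient is a sum over pairs of
    coefficients. The two pairs containing C^(-1) give the cross term of
    f^(k), those containing C^(0) - D_v give the terms with D_v of G^(k+1), and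
    the factorials of the remaining ones combine into the binomial
    coefficients. *)
Lemma fX_ge0E k : (k.+1 <= K)%N ->
  fX mu v C (k.+1%:Z - 1) x = (k`!)%:R * diff_poly`_k.+2.
Proof.
move=> kK; have -> : fX mu v C (k.+1%:Z - 1) x = C k.+1%:Z x
    - k.+1%:R^-1 * quad (grad (C (-1))) (grad (C k.+1%:Z)) - GX mu v C k.+1 x.
  by rewrite fX_succF.
rewrite coef_diff_poly ?ltnS//=.
have lgSS h : (h <= k)%N -> log_grad h.+2 = _ := fun hk => 
  log_gradSS (leq_trans (hk : (h.+1 <= k.+1)%N) kK).
have kf : (k`!)%:R != 0 :> R by rewrite pnatr_eq0 -lt0n fact_gt0.
have k1 : k.+1%:R != 0 :> R by [].
have factkS : ((k.+1)`!%:R : R) = k.+1%:R * (k`!)%:R by rewrite factS natrM.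
rewrite big_ord_recl big_ord_recr /= subn0 /bump/= !add1n subnn.
rewrite [quad (log_grad k.+2) _]quadC lgSS// quadZr.
case: k kK lgSS kf k1 factkS => [|k] kK lgSS kf k1 factkS.
  rewrite big_ord_recl big_ord0 /bump/= GX1E.
  rewrite -[quad _ (log_grad (2 - _)%N)]/(quad (log_grad 1) (log_grad 1)).
  rewrite -[log_grad 0]/(grad (C (-1))) -[fun y => _]/(log_coef 1).
  rewrite fact0 (_ : 1`! = 1%N)//; move: (drift_op _) (quad (log_grad 1) _) => a b.
  by field.
rewrite /= big_ord_recl big_ord_recr /= /bump/=.
set g1 := grad (C k.+1%:Z); set gm := grad (C (-1)); set g0 := grad (C 0).
set gD := grad (Dv v); have kf1 : ((k.+1)`!)%:R != 0 :> R := kf.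
have E1 : quad (log_grad (1 + 0)%N) (log_grad (k.+3 - (1 + 0))%N) =
    ((k.+1)`!%:R)^-1 * (quad g0 g1 - quad gD g1).
  rewrite addn0 subn1/= log_grad1 log_gradSS; last by lia.
  by rewrite quadZr quadBl.
have E2 : quad (log_grad (1 + (1 + k))%N) (log_grad (k.+3 - (1 + (1 + k)))%N) =
    ((k.+1)`!%:R)^-1 * (quad g0 g1 - quad gD g1).
  by rewrite -E1 quadC; congr (quad (log_grad _) (log_grad _)); lia.
have E3 : \sum_(i < k) quad (log_grad (1 + (1 + i))%N)
        (log_grad (k.+3 - (1 + (1 + i)))%N) =
    ((k.+1)`!%:R)^-1 * \sum_(i < k) 'C(k.+1, i.+1)%:R *
      quad (grad (C i.+1%:Z)) (grad (C (k.+1 - i.+1)%N%:Z)).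
  rewrite mulr_sumr; apply: eq_bigr => i _; have ik := ltn_ord i.
  rewrite (_ : k.+3 - _ = (k - i.+1).+2)%N; last by lia.
  rewrite !add1n !log_gradSS; try by lia.
  rewrite (_ : (k - i.+1).+1 = (k.+1 - i.+1)%N); last by lia.
  rewrite quadZl quadZr mulrA mulrA; congr (_ * _).
  have ik1 : (i.+1 <= k.+1)%N by lia.
  have fact_neq0 n : (n`!)%:R != 0 :> R by rewrite pnatr_eq0 -lt0n fact_gt0.
  have : 'C(k.+1, i.+1)%:R * ((i.+1)`!%:R * (k.+1 - i.+1)`!%:R) = (k.+1)`!%:R :> R.
    by rewrite -!natrM bin_fact.
  move: (fact_neq0 i.+1) (fact_neq0 (k.+1 - i.+1)%N) (fact_neq0 k.+1).
  move: ((i.+1)`!%:R) ((k.+1 - i.+1)`!%:R) ((k.+1)`!%:R) ('C(_, _)%:R).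
  move=> a b c d a0 b0 c0 dc.
  move: c0; rewrite -dc !mulf_eq0 !negb_or => /and3P[d0 _ _].
  by field; rewrite a0 b0 d0.
have E4 : GX2 mu v C k.+2 x = - drift_op (C k.+1%:Z) + 2^-1 * (quad g0 g1
    - 2 * quad gD g1 + (quad g0 g1 + \sum_(i < k) 'C(k.+1, i.+1)%:R *
      quad (grad (C i.+1%:Z)) (grad (C (k.+1 - i.+1)%N%:Z)))).
  by rewrite GX2E/= big_ord_recl/= bin0 mul1r subn0.
rewrite E1 E2 E3 E4 drift_opZ; last by apply: smoothCn; lia.
move: (\sum_(i < k) _) (drift_op _) (quad g0 g1) (quad gD g1) => S D q01 qD1.
rewrite -[log_grad 0]/gm factkS; move: (quad gm _) (C _ x) => qm c.
have -> : k.+3%:R = k.+2%:R + 1 :> R by rewrite -natr1.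
move: k1 kf1; move: (k.+2%:R) ((k.+1)`!%:R) => p q p0 q0.
by field; rewrite p0 q0.
Qed.

Lemma fX_eq0 (k : int) : laurent_terms_vanish (-2) (K%:Z - 1)
    (fun Delta => kolmogorov_diff mu v (log_expansion v K C) Delta x) ->
  -1 <= k <= K%:Z -> fX mu v C (k - 1) x = 0.
Proof.
move=> /diff_poly0 dp0 kK.
case: k kK => [[|k]|[|k]] kK; last by lia.
- by rewrite sub0r fX_m1E dp0.
- by rewrite fX_ge0E ?dp0 ?mulr0//; lia.
- by rewrite (_ : Negz 0 - 1 = -2)// fX_m2E dp0 ?mulr0.
Qed.

End Coefficients.

End KolmogorovExpansion.

(** * Jets of the equations for the coefficients *)

Section CoefficientSystem.
Context {R : realType} {m : nat}.
Local Notation E := 'rV[R]_m.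
Local Notation multi := (@multi m).

Variables (U : set E) (oU : open U) (x0 : E) (Ux0 : U x0).
Variables (mu : E -> E) (v : E -> 'M[R]_m).
Hypothesis smu : forall i, smooth U (fun x => mu x ord0 i).
Hypothesis sv : forall i j, smooth U (fun x => v x i j).
Hypothesis detv_gt0 : forall x, U x -> 0 < \det (v x).

Let sDv : smooth U (Dv v) := smooth_Dv oU sv detv_gt0.

Lemma jet_eq_sum2 N (V : 'I_m -> 'I_m -> E -> R) (B B' : 'I_m -> 'I_m -> E -> R) :
  (forall i j, smooth U (V i j)) ->
  (forall i j, jet_eq U x0 N (B i j) (B' i j)) ->
  jet_eq U x0 N (fun x => \sum_i \sum_j V i j x * B i j x)
                (fun x => \sum_i \sum_j V i j x * B' i j x).
Proof.
move=> sV BB; apply: (jet_eq_sum oU Ux0) => i _; apply: (jet_eq_sum oU Ux0) => j _.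
by apply: (jet_eqM oU Ux0) => //; exact: jet_eq_refl.
Qed.

(** Each of the functions G^(k) is, up to a quadratic term, an instance of this
    operator with [A] and [B] built from derivatives of the coefficients. *)
Lemma jet_eq_forward_op N (s : E -> R) (M : 'I_m -> E -> R)
    (dV V : 'I_m -> 'I_m -> E -> R) (A A' : 'I_m -> E -> R)
    (B B' : 'I_m -> 'I_m -> E -> R) :
  smooth U s -> (forall i, smooth U (M i)) ->
  (forall i j, smooth U (dV i j)) -> (forall i j, smooth U (V i j)) ->
  (forall i, jet_eq U x0 N (A i) (A' i)) ->
  (forall i j, jet_eq U x0 N (B i j) (B' i j)) ->
  jet_eq U x0 N
    (fun x => s x - (\sum_i M i x * A i x) + (\sum_i \sum_j dV i j x * A j x)
              + 2^-1 * (\sum_i \sum_j V i j x * B i j x))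
    (fun x => s x - (\sum_i M i x * A' i x) + (\sum_i \sum_j dV i j x * A' j x)
              + 2^-1 * (\sum_i \sum_j V i j x * B' i j x)).
Proof.
move=> ss sM sdV sV AA BB; apply: (jet_eqD oU Ux0); [apply: (jet_eqD oU Ux0)|].
- apply: (jet_eqB oU Ux0); first exact: jet_eq_refl.
  apply: (jet_eq_sum oU Ux0) => i _.
  by apply: (jet_eqM oU Ux0) => //; exact: jet_eq_refl.
- by apply: (@jet_eq_sum2 N dV (fun _ => A) (fun _ => A')).
- apply: (jet_eqM oU Ux0); last exact: jet_eq_sum2.
  exact: (jet_eq_refl oU Ux0 _ (smooth_cst oU _)).
Qed.

Section Jets.
Variables (C C' : int -> E -> R).

Let vc i j x := v x i j.
Let dvc i j := pd i (fun x => v x i j).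
Let muc i x := mu x ord0 i.

Lemma GX0_jet N : jet_eq U x0 N.+2 (C (-1)) (C' (-1)) ->
  jet_eq U x0 N (GX0 mu v C) (GX0 mu v C').
Proof.
move=> CC; have p1 i := jet_eq_pd oU Ux0 i CC.
have p2 i j := jet_eq_pd oU Ux0 i (jet_eq_pd oU Ux0 j CC).
have {}p1 i := jet_eq_le (leqnSn N) (p1 i).
have op := @jet_eq_forward_op N (fun=> m%:R / 2) muc dvc vc
  (fun i => pd i (C (-1))) (fun i => pd i (C' (-1))) _ _
  (smooth_cst oU _) smu (fun i j => smooth_pd i (sv i j)) sv p1 p2.
have last_sum : jet_eq U x0 N
    (fun x => \sum_i \sum_j vc i j x * pd i (C (-1)) x * pd j (Dv v) x)
    (fun x => \sum_i \sum_j vc i j x * pd i (C' (-1)) x * pd j (Dv v) x).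
  apply: (jet_eq_sum oU Ux0) => i _; apply: (jet_eq_sum oU Ux0) => j _.
  apply: (jet_eqM oU Ux0); last exact: (jet_eq_refl oU Ux0 _ (smooth_pd j sDv)).
  by apply: (jet_eqM oU Ux0) => //; exact: (jet_eq_refl oU Ux0 _ (sv i j)).
exact: (jet_eqB oU Ux0 op last_sum).
Qed.

Lemma GX1_jet N : jet_eq U x0 N.+2 (C 0) (C' 0) ->
  jet_eq U x0 N (GX1 mu v C) (GX1 mu v C').
Proof.
move=> CC; have sD1 i := jet_eq_refl oU Ux0 N (smooth_pd i sDv).
have sD2 i j := jet_eq_refl oU Ux0 N (smooth_pd i (smooth_pd j sDv)).
have p1 i : jet_eq U x0 N (fun x => pd i (C 0) x - pd i (Dv v) x)
                          (fun x => pd i (C' 0) x - pd i (Dv v) x).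
  apply: (jet_eqB oU Ux0) => //.
  exact: jet_eq_le (leqnSn N) (jet_eq_pd oU Ux0 i CC).
have p2 i j := jet_eq_pd oU Ux0 i (jet_eq_pd oU Ux0 j CC).
have ss : smooth U (fun x => - (\sum_i pd i (fun y => mu y ord0 i) x)
    + 2^-1 * (\sum_i \sum_j pd i (pd j (fun y => v y i j)) x)).
  apply: (smoothD oU).
    by apply: (smoothN oU); apply: (smooth_sum oU) => i _; exact: smooth_pd.
  apply: (smoothM oU (smooth_cst oU _)).
  apply: (smooth_sum oU) => i _; apply: (smooth_sum oU) => j _.
  by apply: smooth_pd; exact: smooth_pd.
exact: (@jet_eq_forward_op N _ muc dvc vc _ _ _ _
  ss smu (fun i j => smooth_pd i (sv i j)) sv p1
  (fun i j => jet_eqD oU Ux0 (jet_eqB oU Ux0 (p2 i j) (sD2 i j))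
                             (jet_eqM oU Ux0 (p1 i) (p1 j)))).
Qed.

Lemma GX2_jet N k :
  (forall h : nat, (h < k.+1)%N -> jet_eq U x0 N.+2 (C h%:Z) (C' h%:Z)) ->
  jet_eq U x0 N (GX2 mu v C k.+1) (GX2 mu v C' k.+1).
Proof.
move=> CC.
have p1 (h : nat) i : (h < k.+1)%N -> jet_eq U x0 N (pd i (C h%:Z)) (pd i (C' h%:Z)).
  move=> hk; apply: jet_eq_le (leqnSn N) _.
  by apply: (jet_eq_pd oU Ux0); exact: CC.
have p10 i : jet_eq U x0 N (pd i (C 0)) (pd i (C' 0)) by exact: (p1 0%N).
have p1k i : jet_eq U x0 N (pd i (C k%:Z)) (pd i (C' k%:Z)) by exact: p1.
have p2k i j : jet_eq U x0 N (pd i (pd j (C k%:Z))) (pd i (pd j (C' k%:Z))).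
  by apply: (jet_eq_pd oU Ux0); apply: (jet_eq_pd oU Ux0); exact: CC.
have cst_refl (c : R) := jet_eq_refl oU Ux0 N (smooth_cst oU c).
pose S (C : int -> E -> R) i j x := \sum_(0 <= h < k)
  'C(k, h)%:R * pd i (C h%:Z) x * pd j (C (k - h)%N%:Z) x.
have pS i j : jet_eq U x0 N (S C i j) (S C' i j).
  have SE D : S D i j = fun x =>
      \sum_(h < k) 'C(k, h)%:R * pd i (D h%:Z) x * pd j (D (k - h)%N%:Z) x.
    by apply/funext => x; rewrite /S big_mkord.
  rewrite !SE; apply: (jet_eq_sum oU Ux0) => h _.
  have hk : (k - h < k.+1)%N by rewrite ltnS leq_subr.
  apply: (jet_eqM oU Ux0 _ (p1 _ j hk)).
  have hk' : (h < k.+1)%N by rewrite ltnS ltnW.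
  exact: (jet_eqM oU Ux0 (cst_refl _) (p1 _ i hk')).
have op := @jet_eq_forward_op N _ muc dvc vc _ _ _ _ (smooth_cst oU 0) smu
  (fun i j => smooth_pd i (sv i j)) sv p1k p2k.
have sD1 i := jet_eq_refl oU Ux0 N (smooth_pd i sDv).
have quad_part := jet_eq_sum2 sv (fun i j => jet_eqD oU Ux0
  (jet_eqM oU Ux0 (jet_eqB oU Ux0 (p10 i) (jet_eqM oU Ux0 (cst_refl 2) (sD1 i)))
    (p1k j)) (pS i j)).
apply: (jet_eq_eq oU Ux0 _ _
  (jet_eqD oU Ux0 op (jet_eqM oU Ux0 (cst_refl 2^-1) quad_part))).
- by move=> x _; rewrite sub0r.
- by move=> x _; rewrite sub0r.
Qed.

Lemma GX_jet N (k : nat) :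
  (forall h : int, -1 <= h < k%:Z -> jet_eq U x0 N.+2 (C h) (C' h)) ->
  jet_eq U x0 N (GX mu v C k) (GX mu v C' k).
Proof.
case: k => [|[|k]] CC.
- by apply: GX0_jet; apply: CC; lia.
- by apply: GX1_jet; apply: CC; lia.
- by apply: GX2_jet => h hk; apply: CC; lia.
Qed.

(** The gradient of C^(-1) vanishes at [x0], so the derivatives of C^(k) are only
    needed to one order less than the conclusion. *)
Lemma cross_jet N : (forall i, pd i (C (-1)) x0 = 0) ->
  jet_eq U x0 N.+2 (C (-1)) (C' (-1)) -> forall k, jet_eq U x0 N.+1 (C k) (C' k) ->
  jet_eq U x0 N.+1
    (fun x => \sum_i \sum_j v x i j * pd i (C (-1)) x * pd j (C k) x)
    (fun x => \sum_i \sum_j v x i j * pd i (C' (-1)) x * pd j (C' k) x).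
Proof.
move=> d0 CC k CCk; apply: (jet_eq_sum oU Ux0) => i _.
apply: (jet_eq_sum oU Ux0) => j _; apply: (jet_eqM1l oU Ux0).
- by apply: vanish1; rewrite d0 mulr0.
- apply: (jet_eqM oU Ux0); last exact: jet_eq_pd.
  exact: (jet_eq_refl oU Ux0 _ (sv i j)).
- exact: jet_eq_pd.
Qed.

(** For k = -1 both gradients vanish at [x0], and the conclusion is better by one
    order than in the general case. *)
Lemma cross_m1_jet N : (forall i, pd i (C (-1)) x0 = 0) ->
  jet_eq U x0 N.+2 (C (-1)) (C' (-1)) ->
  jet_eq U x0 N.+2
    (fun x => \sum_i \sum_j v x i j * pd i (C (-1)) x * pd j (C (-1)) x)
    (fun x => \sum_i \sum_j v x i j * pd i (C' (-1)) x * pd j (C' (-1)) x).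
Proof.
move=> d0 CC; apply: (jet_eq_sum oU Ux0) => i _.
apply: (jet_eq_sum oU Ux0) => j _; apply: (jet_eqM1 oU Ux0).
- by apply: vanish1; rewrite d0 mulr0.
- by apply: vanish1; rewrite -(jet_eq_at0 (jet_eq_pd oU Ux0 j CC)).
- apply: (jet_eqM oU Ux0); last exact: jet_eq_pd.
  exact: (jet_eq_refl oU Ux0 _ (sv i j)).
- exact: jet_eq_pd.
Qed.

End Jets.

(** The orders [j_k] are chosen for this: the second derivatives in [GX] cost two
    orders, which is the difference between [j_(k-1)] and [j_k]. *)
Lemma fX_jet K (C C' : int -> E -> R) (k : int) : -1 <= k <= K%:Z ->
  (forall h : int, -1 <= h <= k -> jet_eq U x0 (jord K h).+1 (C h) (C' h)) ->
  (forall i, pd i (C (-1)) x0 = 0) ->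
  jet_eq U x0 (jord K k).+1 (fX mu v C (k - 1)) (fX mu v C' (k - 1)).
Proof.
move=> kK CC d0.
have Gk (n : nat) : k = n%:Z ->
    jet_eq U x0 (jord K k).+1 (GX mu v C n) (GX mu v C' n).
  move=> kn; apply: GX_jet => h hn; apply: jet_eq_le (CC h _); last by lia.
  by rewrite /jord; lia.
have CCm1 : jet_eq U x0 (jord K (-1)).+1 (C (-1)) (C' (-1)) by apply: CC; lia.
have CCk : jet_eq U x0 (jord K k).+1 (C k) (C' k) by apply: CC; lia.
case: k kK {CC} Gk CCk => [[|n]|[|//]] kK Gk CCk.
- rewrite !fX_m1F; apply: (jet_eqB oU Ux0); last exact: (Gk _ erefl).
  apply: (jet_eqN oU Ux0); apply: cross_jet => //.
  by apply: jet_eq_le CCm1; rewrite /jord; lia.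
- rewrite !fX_succF; apply: (jet_eqB oU Ux0); last exact: (Gk _ erefl).
  apply: (jet_eqB oU Ux0) => //; apply: (jet_eqM oU Ux0).
    exact: (jet_eq_refl oU Ux0 _ (smooth_cst oU _)).
  apply: cross_jet => //.
  by apply: jet_eq_le CCm1; rewrite /jord; lia.
- rewrite !fX_m2F; apply: (jet_eqB oU Ux0).
    apply: (jet_eqM oU Ux0) => //.
    exact: (jet_eq_refl oU Ux0 _ (smooth_cst oU _)).
  have JE : jord K (-1) = (2 * K + 3).+1 by rewrite /jord; lia.
  by rewrite -[Negz 0]/(-1 : int) JE in CCm1 *; exact: cross_m1_jet.
Qed.

Lemma GX_ext (C C' : int -> E -> R) (k : nat) :
  (forall h : int, -1 <= h < k%:Z -> C h = C' h) -> GX mu v C k = GX mu v C' k.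
Proof.
move=> CC; apply/funext => x; case: k CC => [|[|k]] CC.
- by rewrite /= /GX0 CC.
- by rewrite /= /GX1 CC.
rewrite /= /GX2 /= (CC k.+1%:Z) ?(CC 0)//; try by lia.
congr (_ + _ * _); apply: eq_bigr => i _; apply: eq_bigr => j _.
congr (_ * (_ + _)); rewrite !big_mkord; apply: eq_bigr => h _.
have hk := ltn_ord h; rewrite (CC h%:Z) ?(CC (k.+1 - h)%N%:Z)//; lia.
Qed.

Section System.
Variables (C1 : E -> R) (sC1 : smooth U C1).
Hypothesis grad0 : forall i, pd i C1 x0 = 0.
Hypothesis vunit : v x0 \in unitmx.
Hypothesis hess : hessian x0 C1 = - invmx (v x0).

(** [C1] is, to second order, minus one half of the squared distance for the
    metric frozen at [x0], so its gradient vector is minus the radial one. *)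
Lemma radial_gradient (P : E -> R) j : jet_eq U x0 3 C1 P ->
  vanish x0 2 (fun x => (\sum_i v x i j * pd i P x) + (x ord0 j - x0 ord0 j)).
Proof.
move=> CP; have [_ sP _] := CP.
have p1 i : pd i P x0 = 0 by rewrite -(jet_eq_at0 (jet_eq_pd oU Ux0 i CP)).
have p2 l i : pd l (pd i P) x0 = - invmx (v x0) l i.
  rewrite -(jet_eq_at0 (jet_eq_pd oU Ux0 l (jet_eq_pd oU Ux0 i CP))).
  by have /matrixP/(_ l i) := hess; rewrite !mxE.
have sdP i := smooth_pd i sP.
have svP i : smooth U (fun x => v x i j * pd i P x) by exact: smoothM.
have sc := smooth_coordB oU j (x0 ord0 j).
apply: vanishS => [|l].
  by rewrite subrr addr0 big1// => i _; rewrite p1 mulr0.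
apply: vanish1; rewrite pdD; last 2 first.
- by apply: smooth_diff Ux0; apply: smooth_sum.
- exact: smooth_diff sc Ux0.
have Ux0' : x0 \in U by exact: mem_set.
have sumE : pd l (fun x => \sum_i v x i j * pd i P x) x0 =
    \sum_i pd l (fun x => v x i j * pd i P x) x0.
  exact: (iterpd_sum oU [:: l] svP Ux0').
rewrite pd_coordB sumE.
have -> : \sum_i pd l (fun x => v x i j * pd i P x) x0 = - (invmx (v x0) *m v x0) l j.
  rewrite mxE -sumrN; apply: eq_bigr => i _.
  rewrite pdM; [|exact: smooth_diff (sv i j) Ux0|exact: smooth_diff (sdP i) Ux0].
  by rewrite p1 mulr0 add0r p2; ring.
by rewrite mulVmx// mxE addNr.
Qed.

(** By Euler's identity, the cross term acts on the homogeneous part of lowest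
    degree as minus the multiplication by the degree. *)
Lemma taylor_coef_cross (P : E -> R) n N (d : multi -> R) (i : multi) :
  jet_eq U x0 3 C1 P -> (forall l, (tr l < n)%N -> d l = 0) ->
  tr i = n -> (n <= N)%N ->
  taylor_coef (fun x => \sum_i \sum_j v x i j * pd i P x * pd j (tpoly N x0 d) x)
    x0 i = - n%:R * d i.
Proof.
move=> CP dn in_ nN; have [_ sP _] := CP.
pose D := tpoly N x0 d; have sD : smooth U D by exact: smooth_tpoly.
have vD : vanish x0 n D.
  apply: (vanish_taylor oU Ux0 sD) => l ln.
  by rewrite taylor_coef_tpoly dn ?mulr0.
pose W j x := (\sum_i v x i j * pd i P x) + (x ord0 j - x0 ord0 j).
have sW j : smooth U (W j).
  apply: (smoothD oU); last exact: smooth_coordB.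
  by apply: (smooth_sum oU) => l _; apply: smoothM => //; exact: smooth_pd.
pose F x := \sum_j W j x * pd j D x.
pose T := tpoly N x0 (fun l => (tr l)%:R * d l).
have sF : smooth U F.
  by apply: (smooth_sum oU) => l _; apply: smoothM => //; exact: smooth_pd.
have sT : smooth U T by exact: smooth_tpoly.
have vF : vanish x0 n.+1 F.
  have Fj j : jet_eq U x0 n.+1 (fun x => W j x * pd j D x) (fun=> 0).
    split; [by apply: smoothM => //; exact: smooth_pd|exact: smooth_cst|].
    apply: (vanish_eq oU Ux0 (f := fun x => W j x * pd j D x)).
      by move=> x _; rewrite subr0.
    have := vanishM oU Ux0 (sW j) (smooth_pd j sD) (radial_gradient j CP)
      (vanish_pd j vD).
    by apply: vanish_le; lia.
  have [_ _] := @jet_eq_sum _ _ _ oU _ Ux0 n.+1 _ (index_enum 'I_m) xpredT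
    _ _ (fun j _ => Fj j).
  by apply: (vanish_eq oU Ux0) => x _; rewrite /= big1_eq subr0.
have -> : (fun x => \sum_i \sum_j v x i j * pd i P x * pd j D x) =
    (fun x => F x + - T x).
  apply/funext => x; rewrite /T -tpoly_euler -/D /F exchange_big/= -sumrB.
  apply: eq_bigr => j _; rewrite /W -mulr_suml -mulrBl; congr (_ * _).
  by rewrite addrK.
rewrite (taylor_coefD oU Ux0 _ sF (smoothN oU sT)) (taylor_coefN oU Ux0 _ sT).
rewrite (taylor_coef_vanish vF) ?in_// add0r taylor_coef_tpoly in_ nN.
by rewrite mul1r mulNr.
Qed.

End System.
End CoefficientSystem.

(** * The linear systems and the starting terms *)

Section TaylorSystem.
Context {R : realType} {m : nat}.
Local Notation E := 'rV[R]_m.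
Local Notation multi := (@multi m).

Variables (U : set E) (oU : open U) (x0 : E) (Ux0 : U x0).
Variables (mu : E -> E) (v : E -> 'M[R]_m).
Hypothesis smu : forall i, smooth U (fun x => mu x ord0 i).
Hypothesis sv : forall i j, smooth U (fun x => v x i j).
Hypothesis vsym : forall x i j, v x i j = v x j i.
Hypothesis detv_gt0 : forall x, U x -> 0 < \det (v x).
Variables (K : nat) (C : int -> E -> R).
Hypothesis sC : forall k : int, -1 <= k <= K%:Z -> smooth U (C k).
Hypothesis max0 : forall x, U x -> x != x0 -> C (-1) x < C (-1) x0.
Hypothesis fX0 : forall k : int, -1 <= k <= K%:Z ->
  forall x, U x -> fX mu v C (k - 1) x = 0.

Let vunit : v x0 \in unitmx.
Proof. by rewrite unitmxE unitfE lt0r_neq0// detv_gt0. Qed.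

Lemma eikonal_fX x : U x ->
  - 2 * C (-1) x = \sum_i \sum_j v x i j * pd i (C (-1)) x * pd j (C (-1)) x.
Proof.
move=> Ux; apply/eqP; rewrite -subr_eq0; apply/eqP.
by have := fX0 (k := -1) _ Ux; rewrite fX_m2F; apply; lia.
Qed.

Let sCm1 : smooth U (C (-1)). Proof. by apply: sC; lia. Qed.

Let grad0 : forall i, pd i (C (-1)) x0 = 0 := grad_max0 oU Ux0 sCm1 max0.

Let hess : hessian x0 (C (-1)) = - invmx (v x0) :=
  hessianE oU Ux0 sv sCm1 (vsym x0) eikonal_fX max0.

Let beta (k : int) := taylor_coef (C k) x0.

Let T (h : int) := tpoly (jord K h) x0 (beta h).

Let jet_T (h : int) : -1 <= h <= K%:Z -> jet_eq U x0 (jord K h).+1 (C h) (T h).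
Proof. by move=> hK; apply: jet_eq_tpoly => //; exact: sC. Qed.

(** Truncating the coefficients at the orders [j_h] does not change the jet of
    f^(k-1) to order [j_k], and f^(k-1) is zero for the exact coefficients. *)
Lemma expansion_eqn_beta (k : int) i : -1 <= k <= K%:Z -> (tr i <= jord K k)%N ->
  expansion_eqn mu v K x0 beta k (beta k) i = 0.
Proof.
move=> kK ik; rewrite /expansion_eqn.
have -> : (fun h => tpoly (jord K h) x0 (if h == k then beta k else beta h)) = T.
  by apply/funext => h; case: eqVneq => [->|].
have jT : jet_eq U x0 (jord K k).+1 (fX mu v C (k - 1)) (fX mu v T (k - 1)).
  by apply: fX_jet => // h hk; apply: jet_T; lia.
rewrite -(jet_eq_taylor_coef oU Ux0 jT)// (@taylor_coef_eq _ _ _ oU _ Ux0 _ (fun=> 0)).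
  by rewrite /taylor_coef iterpd0 mul0r.
by move=> x /set_mem Ux; rewrite fX0.
Qed.

Section Step.
Variables (k : int) (n : nat).
Hypothesis kK : -1 <= k <= K%:Z.
Hypothesis nK : (first_unknown k <= n <= jord K k)%N.
Variable g : multi -> R.
Hypothesis known : forall l : multi, (tr l < n)%N -> g l = beta k l.

Let g0 (l : multi) := if (tr l < n)%N then beta k l else 0.
Let d (l : multi) := g l - g0 l.
Let TG h := tpoly (jord K h) x0 (if h == k then g else beta h).
Let T0 h := tpoly (jord K h) x0 (if h == k then g0 else beta h).
Let D := tpoly (jord K k) x0 d.

Let d_small l : (tr l < n)%N -> d l = 0.
Proof. by move=> ln; rewrite /d /g0 ln known// subrr. Qed.

Let d_n l : tr l = n -> d l = g l.
Proof. by move=> ln; rewrite /d /g0 ln ltnn subr0. Qed.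

Let TGk : TG k = fun x => T0 k x + D x.
Proof.
apply/funext => x; rewrite /TG /T0 eqxx /D /tpoly -big_split/=.
by apply: eq_bigr => l _; rewrite -mulrDl /d addrC subrK.
Qed.

Let TGh h : h != k -> TG h = T0 h.
Proof. by move=> /negbTE hk; rewrite /TG /T0 hk. Qed.

Let sD : smooth U D := smooth_tpoly oU _ _ _.
Let sT0 h : smooth U (T0 h) := smooth_tpoly oU _ _ _.

(** When the unknowns are coefficients of C^(-1) their degree is at least
    three, so its leading quadratic part is known. *)
Let jet_m1 (c : multi -> R) : (forall l : multi, (tr l < n)%N -> c l = beta k l) ->
  jet_eq U x0 3 (C (-1)) (tpoly (jord K (-1)) x0 (if -1 == k then c else beta (-1))).
Proof.
move=> cP; have J3 : (3 <= (jord K (-1)).+1)%N by rewrite /jord; lia.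
have jT3 : jet_eq U x0 3 (C (-1)) (T (-1)) by apply: jet_eq_le J3 (jet_T _); lia.
have [km1|//] := eqVneq (-1) k.
apply: (jet_eq_trans oU Ux0 jT3); split; [exact: smooth_tpoly|exact: smooth_tpoly|].
have n3 : (3 <= n)%N by move: nK; rewrite -km1 => /andP[].
apply: (vanish_taylor oU Ux0).
  by apply: (smoothB oU); exact: smooth_tpoly.
move=> l l3; rewrite (taylor_coefD oU Ux0); last 2 first.
- exact: smooth_tpoly.
- by apply: (smoothN oU); exact: smooth_tpoly.
rewrite (taylor_coefN oU Ux0); last exact: smooth_tpoly.
by rewrite !taylor_coef_tpoly cP -?km1 ?subrr// (leq_trans l3).
Qed.

Let jet_TG : jet_eq U x0 3 (C (-1)) (TG (-1)).
Proof. exact: jet_m1 known. Qed.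

Let jet_T0 : jet_eq U x0 3 (C (-1)) (T0 (-1)).
Proof. by apply: jet_m1 => l ln; rewrite /g0 ln. Qed.

Let cross P Q x := \sum_i \sum_j v x i j * pd i P x * pd j Q x : R.

Let smooth_cross P Q : smooth U P -> smooth U Q -> smooth U (cross P Q).
Proof.
move=> sP sQ; apply: (smooth_sum oU) => i _; apply: (smooth_sum oU) => j _.
by apply: (smoothM oU); [apply: (smoothM oU) => //|]; exact: smooth_pd.
Qed.

Let crossDr P Q Q' : smooth U Q -> smooth U Q' ->
  {in U, cross P (fun x => Q x + Q' x) =1 fun x => cross P Q x + cross P Q' x}.
Proof.
move=> sQ sQ' x /set_mem Ux; rewrite /cross -big_split; apply: eq_bigr => i _.
rewrite -big_split; apply: eq_bigr => j _ /=.
by rewrite pdD ?mulrDr//; exact: smooth_diff Ux.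
Qed.

Let crossC P Q x : cross P Q x = cross Q P x.
Proof. exact: quadC vsym x (grad x P) (grad x Q). Qed.

Let coef_cross P i : jet_eq U x0 3 (C (-1)) P -> tr i = n ->
  taylor_coef (cross P D) x0 i = - n%:R * g i.
Proof.
move=> CP in_; have /andP[_ nj] := nK.
by rewrite (taylor_coef_cross oU Ux0 sv grad0 vunit hess CP d_small in_ nj) d_n.
Qed.

Let coef_D i : tr i = n -> taylor_coef D x0 i = g i.
Proof.
by move=> in_; rewrite taylor_coef_tpoly d_n// in_; case/andP: nK => _ ->; rewrite mul1r.
Qed.

Let sfX0 : smooth U (fX mu v T0 (k - 1)).
Proof.
have d0 i : pd i (T0 (-1)) x0 = 0.
  by rewrite -(jet_eq_at0 (jet_eq_pd oU Ux0 i jet_T0)).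
have [//] := fX_jet oU Ux0 smu sv detv_gt0 kK
  (fun h _ => jet_eq_refl oU Ux0 (jord K h).+1 (sT0 h)) d0.
Qed.

(** Adding to C^(k) a polynomial [D] without terms of degree below [n] changes
    f^(k-1) by a multiple of [D] and cross terms of [D] with C^(-1), to which
    [taylor_coef_cross] applies. For k = -1 the change of the quadratic cross term
    is the sum of two bilinear ones, by polarization. *)
Lemma expansion_eqnE i : tr i = n ->
  expansion_eqn mu v K x0 beta k g i =
  expansion_eqn mu v K x0 beta k g0 i + pivot k n * g i.
Proof.
move=> in_; rewrite /expansion_eqn -/TG -/T0.
suff [F [FE sF Fi]] : exists F : E -> R,
    [/\ {in U, fX mu v TG (k - 1) =1 fun x => fX mu v T0 (k - 1) x + F x},
        smooth U F & taylor_coef F x0 i = pivot k n * g i].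
  apply: etrans (taylor_coef_eq oU Ux0 i FE) _.
  by rewrite (taylor_coefD oU Ux0 i sfX0 sF) Fi.
have GXE (p : nat) : k = p%:Z -> GX mu v TG p = GX mu v T0 p.
  by move=> kp; apply: GX_ext => h hp; apply: TGh; lia.
have TZ := taylor_coefZ oU Ux0; have TN := taylor_coefN oU Ux0.
have TD := taylor_coefD oU Ux0.
have sZ c (F : E -> R) : smooth U F -> smooth U (fun x => c * F x).
  by move=> sF; apply: (smoothM oU) => //; exact: smooth_cst.
have sTG h : smooth U (TG h) by exact: smooth_tpoly.
have scD h : smooth U (cross (T0 h) D) by exact: smooth_cross.
have scGD h : smooth U (cross (TG h) D) by exact: smooth_cross.
have [km1|k1] := eqVneq k (-1).
  exists (fun x => - 2 * D x + - (cross (T0 (-1)) D x + cross (TG (-1)) D x)).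
  have scc : smooth U (fun x => cross (T0 (-1)) D x + cross (TG (-1)) D x).
    exact: (smoothD oU).
  split; last 1 first.
  - rewrite TD; [|exact: sZ|exact: smoothN].
    rewrite TZ// TN// TD// coef_D// (coef_cross jet_T0)// (coef_cross jet_TG)//.
    rewrite /pivot km1 eqxx; ring.
  - move=> x Ux; have TGm1 : TG (-1) = fun x => T0 (-1) x + D x by rewrite -km1 TGk.
    have cG P : cross P (TG (-1)) x = cross P (T0 (-1)) x + cross P D x.
      by rewrite TGm1 crossDr.
    have cGG : cross (TG (-1)) (TG (-1)) x =
        cross (T0 (-1)) (T0 (-1)) x + cross (T0 (-1)) D x + cross (TG (-1)) D x.
      by rewrite cG crossC cG.
    rewrite km1; change (- 2 * TG (-1) x - cross (TG (-1)) (TG (-1)) x =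
      (- 2 * T0 (-1) x - cross (T0 (-1)) (T0 (-1)) x) +
      (- 2 * D x + - (cross (T0 (-1)) D x + cross (TG (-1)) D x))).
    by rewrite cGG TGm1; ring.
  - by apply: (smoothD oU); [exact: sZ|exact: smoothN].
have TGm1 : TG (-1) = T0 (-1) by rewrite TGh// eq_sym.
have [p kp] : exists p : nat, k = p%:Z by exists `|k|%N; lia.
case: p kp => [|p] kp.
  exists (fun x => - cross (T0 (-1)) D x); split.
  - move=> x Ux; have TG0 : TG 0 = fun x => T0 0 x + D x.
      by have := TGk; rewrite kp.
    have cG : cross (T0 (-1)) (TG 0) x = cross (T0 (-1)) (T0 0) x + cross (T0 (-1)) D x.
      by rewrite TG0 crossDr.
    rewrite kp !fX_m1F (GXE 0%N)// TGm1.
    change (- cross (T0 (-1)) (TG 0) x - GX mu v T0 0 x =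
      (- cross (T0 (-1)) (T0 0) x - GX mu v T0 0 x) + - cross (T0 (-1)) D x).
    by rewrite cG; ring.
  - exact: smoothN.
  - rewrite TN// (coef_cross jet_T0)// /pivot kp /=; ring.
exists (fun x => D x + - p.+1%:R^-1 * cross (T0 (-1)) D x); split.
- move=> x Ux; have TGp : TG p.+1%:Z = fun x => T0 p.+1%:Z x + D x by rewrite -kp TGk.
  have cG : cross (T0 (-1)) (TG p.+1%:Z) x =
      cross (T0 (-1)) (T0 p.+1%:Z) x + cross (T0 (-1)) D x.
    by rewrite TGp crossDr.
  rewrite kp !fX_succF (GXE p.+1)// TGm1.
  change (TG p.+1%:Z x - p.+1%:R^-1 * cross (T0 (-1)) (TG p.+1%:Z) x
      - GX mu v T0 p.+1 x =
    (T0 p.+1%:Z x - p.+1%:R^-1 * cross (T0 (-1)) (T0 p.+1%:Z) x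
      - GX mu v T0 p.+1 x) + (D x + - p.+1%:R^-1 * cross (T0 (-1)) D x)).
  by rewrite cG TGp; ring.
- by apply: (smoothD oU) => //; exact: sZ.
- rewrite TD//; last exact: sZ.
  rewrite TZ// coef_D// (coef_cross jet_T0)// /pivot kp /= -pmulrn; ring.
Qed.

End Step.
Lemma pivot_neq0 (k : int) n : -1 <= k -> (first_unknown k <= n)%N ->
  pivot k n != 0 :> R.
Proof.
rewrite /first_unknown /pivot; have [->|km1] := eqVneq k (-1).
  move=> _ n3; rewrite mulf_neq0// subr_eq0 -[1]/(1%:R) eqr_nat; lia.
have [-> _ n1|k0 k1 _] := eqVneq k 0; first by rewrite pnatr_eq0; lia.
rewrite gt_eqF// (lt_le_trans ltr01)// lerDl divr_ge0// ler0z; lia.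
Qed.

(** The matrix of the system is the scalar [pivot k n]. *)
Lemma linear_step_taylor (k : int) n : -1 <= k <= K%:Z ->
  (first_unknown k <= n <= jord K k)%N -> linear_step mu v K x0 beta k n.
Proof.
move=> kK nK; have /andP[nk nj] := nK; have /andP[k1 _] := kK.
pose g0 (l : multi) := if (tr l < n)%N then beta k l else 0.
pose b i := - expansion_eqn mu v K x0 beta k g0 i.
have eqnE g : (forall l : multi, (tr l < n)%N -> g l = beta k l) ->
    forall i, tr i = n -> expansion_eqn mu v K x0 beta k g i = pivot k n * g i - b i.
  move=> known i in_; rewrite (expansion_eqnE kK nK known in_) /b opprK.
  by rewrite addrC.
have piv0 := pivot_neq0 k1 nk.
split.
- exists (fun i l => pivot k n * (l == i)%:R), b => g known i in_.
  rewrite eqnE//; congr (_ - _).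
  transitivity (\sum_(l <- midx n) (pivot k n * g l) * (l == i)%:R).
    by rewrite sum_midx_pick in_ leqnn mul1r.
  rewrite [RHS]big_mkcond; apply: eq_bigr => l _.
  case: ifPn => [_|ln]; first by rewrite mulrAC.
  have [li|_] := eqVneq l i; last by rewrite mulr0.
  by rewrite li in_ eqxx in ln.
- by move=> i in_; apply: expansion_eqn_beta => //; rewrite in_.
- move=> g known; split=> [g_eq i in_|gE i in_].
    rewrite /explicit_solution -/g0 -/(b i).
    by have := g_eq i in_; rewrite eqnE// => /subr0_eq <-; rewrite mulrC mulKf.
  rewrite eqnE// gE// /explicit_solution -/g0 -/(b i).
  by rewrite mulrC divfK// subrr.
Qed.

Lemma monomial_counts s x :
  monomial x0 (counts s) x = \prod_(l <- s) (x ord0 l - x0 ord0 l).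
Proof.
transitivity (\prod_(l < m) (x ord0 l - x0 ord0 l) ^+ count_mem l s).
  by apply: eq_bigr => l _; rewrite ffunE.
elim: s => [|a s IHs]; first by rewrite big_nil big1.
rewrite big_cons -IHs; under eq_bigr => l _ do rewrite /= exprD.
rewrite big_split/=; congr (_ * _).
rewrite (bigD1 a)//= eqxx expr1 big1 ?mulr1// => l la.
by rewrite eq_sym (negbTE la).
Qed.

(** The terms of degree two are read off the Hessian; the sum over pairs (a, b) is
    regrouped by the multi-index e_a + e_b. *)
Lemma starting_terms_taylor : C 0 x0 = 0 -> starting_terms v x0 beta.
Proof.
move=> C00; have C0 := max_value0 oU Ux0 sCm1 eikonal_fX max0.
have v2 : vanish x0 2 (C (-1)) by apply: vanishS => // l; exact: vanish1.
split.
- by move=> i i1; apply: (taylor_coef_vanish v2); rewrite ltnS.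
- move=> x; pose W := invmx (v x0); pose y l := x ord0 l - x0 ord0 l.
  pose e (a b : 'I_m) := counts [:: a; b].
  have WE c d : pd c (pd d (C (-1))) x0 = - W c d.
    by have /matrixP/(_ c d) := hess; rewrite !mxE.
  have coefE i : tr i = 2 -> beta (-1) i =
      \sum_a \sum_b - 2^-1 * W a b * (i == e a b)%:R.
    move=> i2; have := counts_multi_seq i; have := size_multi_seq i.
    rewrite i2; case: (multi_seq i) => [|c [|d []]]// _ icd; rewrite -icd.
    apply: (mulIf (multi_fact_neq0 (counts [:: c; d]))).
    rewrite -(iterpd_taylor oU Ux0 [:: c; d] sCm1) [LHS]WE.
    rewrite mulr_suml; under eq_bigr do rewrite mulr_suml.
    (* Only the pairs (c, d) and (d, c) contribute, both of them when c = d: the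
       factorial is evaluated by differentiating the monomial. *)
    have delta a b : - 2^-1 * W a b * (counts [:: c; d] == e a b)%:R *
        (multi_fact (counts [:: c; d]))%:R =
        - 2^-1 * W a b * ((d == a)%:R * (c == b)%:R + (c == a)%:R * (d == b)%:R).
      rewrite -mulrA; congr (_ * _).
      have := iterpd_monomial0 x0 [:: c; d] (e a b).
      have -> : iterpd [:: c; d] (monomial x0 (e a b)) x0 =
          (d == a)%:R * (c == b)%:R + (c == a)%:R * (d == b)%:R.
        have -> : monomial x0 (e a b) = fun z =>
            (z ord0 a - x0 ord0 a) * (z ord0 b - x0 ord0 b).
          apply/funext => z; rewrite monomial_counts big_cons big_seq1//.
        rewrite /= (pd2M0 oU Ux0) ?subrr//; last 2 first.
        - exact: smooth_coordB.
        - exact: smooth_coordB.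
        by rewrite !pd_coordB.
      rewrite [e a b == _]eq_sym => ->.
      by have [->|_] := eqVneq (counts [:: c; d]) (e a b); rewrite ?mul0r.
    under eq_bigr => a _ do under eq_bigr => b _ do rewrite delta.
    have pick (F : 'I_m -> R) l : \sum_b F b * (l == b)%:R = F l.
      rewrite (bigD1 l)//= eqxx mulr1 big1 ?addr0// => b bl.
      by rewrite eq_sym (negbTE bl) mulr0.
    have -> : W c d = 2^-1 * W d c + 2^-1 * W c d.
      have -> : W d c = W c d by apply: oppr_inj; rewrite -!WE (pdC oU d c sCm1)// inE.
      by field.
    rewrite opprD -!mulNr -[LHS]/(_ + _).
    transitivity (\sum_a ((- 2^-1 * W a c) * (d == a)%:R +
                           (- 2^-1 * W a d) * (c == a)%:R)); last first.
      apply: eq_bigr => a _; rewrite -(pick (fun b => - 2^-1 * W a b * (d == a)%:R)).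
      rewrite -(pick (fun b => - 2^-1 * W a b * (c == a)%:R)) -big_split.
      by apply: eq_bigr => b _ /=; ring.
    by rewrite big_split/= !pick.
  transitivity (\sum_a \sum_b - 2^-1 * W a b * (y a * y b)).
    rewrite (eq_bigr (fun i => \sum_a \sum_b
      - 2^-1 * W a b * monomial x0 i x * (i == e a b)%:R)); last first.
      move=> i /eqP i2; rewrite coefE// mulr_suml; apply: eq_bigr => a _.
      by rewrite mulr_suml; apply: eq_bigr => b _; rewrite mulrAC.
    rewrite exchange_big/=; apply: eq_bigr => a _.
    rewrite exchange_big/=; apply: eq_bigr => b _.
    have -> : y a * y b = monomial x0 (e a b) x.
      by rewrite monomial_counts big_cons big_seq1.
    have := sum_midx_pick 2 (e a b) (fun i => - 2^-1 * W a b * monomial x0 i x).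
    rewrite tr_counts mul1r => <-.
    rewrite big_mkcond; apply: eq_bigr => i _; case: ifPn => // i2.
    have [ie|_] := eqVneq i (e a b); last by rewrite mulr0.
    by rewrite ie tr_counts in i2.
  rewrite mxE mulr_sumr; under [RHS]eq_bigr => b _ do rewrite mxE mulr_suml mulr_sumr.
  rewrite exchange_big/=; apply: eq_bigr => b _; apply: eq_bigr => a _.
  by rewrite !mxE -/W /y; ring.
- move=> i i0; rewrite /beta /taylor_coef -/(multi_seq i).
  have -> : multi_seq i = [::] by apply/size0nil; rewrite size_multi_seq.
  by rewrite /= C00 mul0r.
Qed.

End TaylorSystem.

(** * Diffusion matrices and the theorem *)

Section Diffusions.
Context {R : realType} {m : nat}.
Local Notation E := 'rV[R]_m.

Lemma smooth_on_smooth (S U : set E) (f : E -> R) :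
  open U -> U `<=` S -> smooth_on S f -> smooth U f.
Proof.
move=> oU US [V [g [oV SV sg fg]]].
have : smooth U g by move=> s x Ux; apply: sg; apply: SV; exact: US.
by apply: smooth_eq => // x /set_mem Ux; rewrite fg//; exact: US.
Qed.

Lemma diffusion_mx_sym (sigma : E -> 'M[R]_m) x i j :
  diffusion_mx sigma x i j = diffusion_mx sigma x j i.
Proof.
have -> : diffusion_mx sigma x j i = (diffusion_mx sigma x)^T i j by rewrite [RHS]mxE.
by rewrite /diffusion_mx trmx_mul trmxK.
Qed.

(** The determinant of the diffusion matrix is a square. *)
Lemma det_diffusion_mx_gt0 (sigma : E -> 'M[R]_m) x :
  posdef (diffusion_mx sigma x) -> 0 < \det (diffusion_mx sigma x).
Proof.
move=> pdv; rewrite lt0r; apply/andP; split; last first.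
  by rewrite det_mulmx det_tr -expr2 sqr_ge0.
rewrite -unitfE -unitmxE -row_free_unit; apply: inj_row_free => y yv.
apply/eqP; apply: contraT => /pdv.
by rewrite yv mul0mx mxE ltxx.
Qed.

Lemma smooth_diffusion_mx (U : set E) (sigma : E -> 'M[R]_m) : open U ->
  (forall i j, smooth U (fun x => sigma x i j)) ->
  forall i j, smooth U (fun x => diffusion_mx sigma x i j).
Proof.
move=> oU ss i j.
rewrite (_ : (fun x => _) = fun x => \sum_l sigma x i l * sigma x j l).
  by apply: smooth_sum => // l _; exact: smoothM.
by apply/funext => x; rewrite mxE; apply: eq_bigr => l _; rewrite mxE.
Qed.

End Diffusions.

Theorem theorem2 (R : realType) (m : nat) (m_gt0 : (0 < m)%N)
    (I : 'I_m -> interval R) (mu : 'rV[R]_m -> 'rV[R]_m)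
    (sigma : 'rV[R]_m -> 'M[R]_m) (hX : standing I mu sigma)
    (K : nat) (x0 : 'rV[R]_m) (hx0 : interior (box I) x0)
    (C : int -> 'rV[R]_m -> R)
    (hC : expansion_coefs mu (diffusion_mx sigma) (interior (box I)) K x0 C) :
  let v := diffusion_mx sigma in
  let beta := fun k : int => taylor_coef (C k) x0 in
  [/\ forall k : int, -1 <= k <= K%:Z ->
        forall x, interior (box I) x -> fX mu v C (k - 1) x = 0,
      starting_terms v x0 beta
    & forall (k : int) (n : nat), -1 <= k <= K%:Z ->
        (first_unknown k <= n <= jord K k)%N ->
        linear_step mu v K x0 beta k n].
Proof.
move=> v beta; case: hX => pdv smu_on ssigma_on _ _.
case: hC => sC_on laurent max0 _ C00.
have oU : open (interior (box I)) by exact: open_interior.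
have UB : interior (box I) `<=` box I by exact: interior_subset.
have smu i := smooth_on_smooth oU UB (smu_on i).
have sv := smooth_diffusion_mx oU (fun i j => smooth_on_smooth oU UB (ssigma_on i j)).
have sC k (kK : -1 <= k <= K%:Z) := smooth_on_smooth oU (fun=> id) (sC_on k kK).
have vsym := diffusion_mx_sym sigma.
have detv x (Ux : interior (box I) x) := det_diffusion_mx_gt0 (pdv x Ux).
have fX0 k (kK : -1 <= k <= K%:Z) x (Ux : interior (box I) x) :=
  fX_eq0 oU sv vsym detv sC Ux (laurent x Ux) kK.
split=> //.
- exact: (starting_terms_taylor oU hx0 sv vsym detv sC max0 fX0).
- move=> k n; exact: (linear_step_taylor oU hx0 smu sv vsym detv sC max0 fX0).
Qed.
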